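(* Let $T>0$, let $N$ be a positive even integer, let $x_j=Tj/N$ for $j=0,\dots,N-1$, and suppose that $f\in\mathcal{A}_{T,\beta}$ for some $\beta>0$. Let $\mathbf{\Theta}=(\theta_{l,j})_{0\le l,j\le N-1}$ be the first-order Fourier integration matrix of size $N$. Then, componentwise in $l\in\{0,\dots,N-1\}$, $$\left|\int_0^{x_l} f(x)\,dx-\sum_{j=0}^{N-1}\theta_{l,j}f(x_j)\right| = O\left(e^{-\omega_{N\beta/2}}\right)\quad\text{as } N\to\infty ,$$ i.e. the vector of absolute quadrature errors is $O\left(e^{-\omega_{N\beta/2}}\mathbf{1}_N\right)$, where $\mathbf{1}_N$ is the all-ones vector of length $N$ (the implied constant being independent of $l$ and $N$). Moreover, if $f$ is $\beta$-analytic, then $$\left|\int_0^{x_l} f(x)\,dx-\sum_{j=0}^{N-1}\theta_{l,j}f(x_j)\right| = 0\quad\text{for all } l\in\{0,\dots,N-1\}.$$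
   Context: Notation: $\omega_\alpha=\frac{2\pi\alpha}{T}$ for every real $\alpha$; thus $\omega_k=2\pi k/T$ and $\omega_{N\beta/2}=\pi N\beta/T$. Fourier integration matrix: for $l,j\in\{0,\dots,N-1\}$, $$\theta_{l,j}=\frac1N\left[x_l+\frac{Ti}{2\pi}\sum_{\substack{k=-N/2\\ k\ne0}}^{N/2-1}\frac1k e^{-i\omega_k x_j}\left(1-e^{i\omega_k x_l}\right)\right].$$ Equivalently, $\sum_{j}\theta_{l,j}f(x_j)=\int_0^{x_l}I_Nf(x)\,dx$, where $I_Nf(x)=\sum_{k=-N/2}^{N/2-1}\tilde f_k e^{i\omega_k x}$, $\tilde f_k=\frac1N\sum_{j=0}^{N-1}f(x_j)e^{-i\omega_k x_j}$, is the Fourier interpolant of $f$ at the nodes $x_j$. For $\beta>0$, $\mathbf{C}_{T,\beta}=\{x+iy: x\in[0,T],\ y\in[-\beta,\beta]\}\subset\mathbb{C}$, and $\mathbf{C}_{T,\infty}=\{x+iy: x\in[0,T],\ y\in\mathbb{R}\}$. For $s\in\mathbb{Z}_{\ge 0}$, $\mathcal{H}_T^s$ is the set of $u$ in the Sobolev space $H^s([0,T])$ (derivatives up to order $s$ in $L^2$) such that $u^{(s)}$ is of bounded variation on $[0,T]$ and $u^{(j)}(0)=u^{(j)}(T)$ for $j=0,\dots,s-1$; $\mathcal{H}_T^\infty$ is the set of functions belonging to $\mathcal{H}_T^s$ for all $s$ (in particular $u^{(j)}(0)=u^{(j)}(T)$ for all $j\ge0$). Functions are allowed to be complex-valued. $\mathcal{A}_{T,\beta}=\{u\in\mathcal{H}_T^\infty: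 u \text{ is analytic in some open set containing } \mathbf{C}_{T,\beta}\}$, with norm $\|u\|_{\mathcal{A}_{T,\beta}}=\|u\|_{L^\infty(\mathbf{C}_{T,\beta})}$. A function $u\in\mathcal{A}_{T,\beta}$ is called $\beta$-analytic if $u$ is analytic on $\mathbf{C}_{T,\infty}$ and $\lim_{\beta\to\infty}\frac{\|u\|_{\mathcal{A}_{T,\beta}}}{e^{\omega_\beta}}=0$ (in the limit, $\beta$ is a dummy variable tending to infinity). *)

(* Defs.v *)
From HB Require Import structures.
From mathcomp Require Import all_boot all_order all_algebra.
From mathcomp Require Import all_classical all_reals all_analysis.
From mathcomp Require Import complex.

Set Implicit Arguments.
Unset Strict Implicit.
Unset Printing Implicit Defensive.

Import Order.TTheory GRing.Theory Num.Theory.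
Import numFieldNormedType.Exports.

Local Open Scope classical_set_scope.
Local Open Scope ring_scope.
Local Open Scope complex_scope.

Section Defs.
Context {R : realType}.
Implicit Types (T beta : R) (N s : nat).

(* The topology on the complex numbers is the one attached to R[i]^o. *)
Local Notation C := (R[i]^o).
Local Notation mu := (@lebesgue_measure R).

Definition expi (t : R) : R[i] := cos t +i* sin t.

Definition cintegral (A : set R) (u : R -> R[i]) : R[i] :=
  Rintegral mu A (fun x => complex.Re (u x)) +i*
  Rintegral mu A (fun x => complex.Im (u x)).

Definition square_integrable (a b : R) (u : R -> R[i]) : Prop :=
  [/\ measurable_fun `[a, b] (fun x => complex.Re (u x)),
      measurable_fun `[a, b] (fun x => complex.Im (u x)) &
      mu.-integrable `[a, b] (fun x => (Normc.normc (u x) ^+ 2)%:E)].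

(* The library's [bounded_variation] only applies to functions from R to R. *)
Definition cbounded_variation (a b : R) (u : R -> R[i]) : Prop :=
  exists M : R, forall p : seq R, itv_partition a b p ->
    let x := nth b (a :: p) in
    \sum_(k < size p) Normc.normc (u (x k.+1) - u (x k)) <= M.

(* The test functions are C^1 with compact support in ]a, b[; in dimension one
   they define the same weak derivatives as the smooth ones. *)
Definition test_function (a b : R) (phi : R -> R) : Prop :=
  [/\ forall x, derivable phi x 1,
      continuous (derive1 phi) &
      exists c d : R, [/\ a < c, d < b &
        forall x, x \notin `[c, d] -> phi x = 0]].

Definition weak_derivative (a b : R) (u v : R -> R[i]) : Prop :=
  forall phi : R -> R, test_function a b phi ->
    cintegral `]a, b[ (fun x => u x * (derive1 phi x)%:C) =
    - cintegral `]a, b[ (fun x => v x * (phi x)%:C).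

(* H^s is described by iterated first-order weak derivatives: [v j] is the
   representative of the j-th weak derivative of u, the continuous one for
   j < s, which gives a meaning to the endpoint values, and one of bounded
   variation for j = s. Only the values of u on [0, T] matter. *)
Definition HT T s (u : R -> R[i]) : Prop :=
  exists v : nat -> R -> R[i],
  [/\ forall x, x \in `[0, T] -> v 0%N x = u x,
      forall j, (j <= s)%N -> square_integrable 0 T (v j),
      forall j, (j < s)%N -> weak_derivative 0 T (v j) (v j.+1),
      forall j, (j < s)%N ->
        {within `[0, T], continuous (v j : R -> C)} /\ v j 0 = v j T &
      cbounded_variation 0 T (v s)].

Definition HT_infty T (u : R -> R[i]) : Prop := forall s, HT T s u.

Definition analytic_at (u : R[i] -> R[i]) (z0 : R[i]) : Prop :=
  exists a : nat -> R[i], \forall z \near (z0 : C),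
    [series (a n * (z - z0) ^+ n : C)]_n @ \oo --> (u z : C).

Definition analytic_near (K : set R[i]) (u : R[i] -> R[i]) : Prop :=
  exists U : set C, [/\ open U, K `<=` U & forall z, U z -> analytic_at u z].

Definition rectangle T beta : set R[i] :=
  [set z | 0 <= complex.Re z <= T /\ - beta <= complex.Im z <= beta].

Definition strip T : set R[i] := [set z | 0 <= complex.Re z <= T].

(* Functions are total on the complex plane; values away from the domain of
   analyticity are irrelevant. *)
Definition A_space T beta (u : R[i] -> R[i]) : Prop :=
  HT_infty T (fun x => u x%:C) /\ analytic_near (rectangle T beta) u.

Definition A_norm T beta (u : R[i] -> R[i]) : \bar R :=
  Lnorm (mu \x mu)%E +oo%E
    ((fun p : R * R => (Normc.normc (u (p.1 +i* p.2)))%:E)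
       \_ [set p | rectangle T beta (p.1 +i* p.2)]).

Definition omega T (alpha : R) : R := 2 * pi * alpha / T.

Definition beta_analytic T beta (u : R[i] -> R[i]) : Prop :=
  [/\ A_space T beta u,
      analytic_near (strip T) u &
      (A_norm T b u * ((expR (omega T b))^-1)%:E)%E @[b --> +oo%R] --> 0%E].

Definition node T N (j : nat) : R := T * j%:R / N%:R.

(* The summation index k = m - N/2 runs over -N/2, ..., N/2 - 1. *)
Definition fourier_integration_matrix T N : 'M[R[i]]_N :=
  \matrix_(l < N, j < N)
    (N%:R^-1 *
     ((node T N l)%:C +
      T%:C * 'i%C / (2 * pi)%:C *
      \sum_(m < N | m != N./2 :> nat)
        let k : R := m%:R - (N./2)%:R in
        (k%:C)^-1 * expi (- (omega T k * node T N j)) *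
        (1 - expi (omega T k * node T N l)))).

Definition quadrature_error T N (f : R[i] -> R[i]) (l : 'I_N) : R :=
  Normc.normc
    (cintegral `[0, node T N l] (fun x => f x%:C) -
     \sum_(j < N) fourier_integration_matrix T N l j * f (node T N j)%:C).

End Defs.

(* Main.v *)
From HB Require Import structures.
Require Import Defs.
From mathcomp Require Import all_boot all_order all_algebra.
From mathcomp Require Import all_classical all_reals all_analysis.
From mathcomp Require Import ess_sup_inf complex ring lra zify.

(* Since all derivatives of f agree at 0 and T, so do the two power series, and
   by the identity theorem f(iy) = f(T + iy) for |y| <= beta. Hence the integral
   c(y) of f(x + iy) e^(-i omega_k x) for x in [0, T] satisfies c' = - omega_k c,
   so that the Fourier coefficients satisfy |c_k| <= 2 M e^(- omega_|k| beta) with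
   M the maximum of |f| on the rectangle. The Fourier series converges pointwise
   to f, and the quadrature replaces the integral of e_k by that of e_k', where
   k' is the representative of k modulo N in [-N/2, N/2[, which is exact for
   k' = k: the error is at most a constant times the sum of the |c_k| with
   |k| >= N/2. If f is beta-analytic, the bound on c_k holds with every beta, with
   M = o(e^(omega_beta)); so c_k = 0 for k <> 0. *)

Set Implicit Arguments.
Unset Strict Implicit.
Unset Printing Implicit Defensive.

Import Order.TTheory GRing.Theory Num.Theory.
Import numFieldNormedType.Exports.

Local Open Scope classical_set_scope.
Local Open Scope ring_scope.

(** * Complex numbers and power series *)

(** Periodicity is given in Sobolev terms, while the argument needs complex derivatives: the
    continuous representatives of the weak derivatives are identified on [0, T] with the complex
    derivatives of f, by integration by parts and a variational argument, and only then do the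
    endpoint conditions concern power series. No contour integral occurs: the differential equation
    for c, which holds at heights strictly between - beta and beta, takes the place of Cauchy's
    theorem, and the full rate is a limit at the boundary. Bounding the rule by the row sums of
    Theta would bring in a constant depending on N. Each mode is therefore charged a fixed multiple
    of T, and the row sums only multiply the remainder of the Fourier series, which tends to 0 with
    N fixed. The norm in the definition of beta-analytic functions is an essential supremum, so the
    pointwise M has to be recovered from it by continuity. Numerical factors come mostly from
    estimating real and imaginary parts separately. *)

Section ComplexModulus.
Context {R : realType}.
Implicit Types x y z : R[i].
Local Notation nc := (@Normc.normc R).

Lemma nc_ge0 z : 0 <= nc z.
Proof. by case: z => a b; exact: sqrtr_ge0. Qed.

Lemma ncD x y : nc (x + y) <= nc x + nc y.
Proof. exact: le_normcD. Qed.

Lemma ncN z : nc (- z) = nc z.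
Proof. exact: normcN. Qed.

Lemma ncB x y : nc (x - y) = nc (y - x).
Proof. by rewrite -ncN opprB. Qed.

Lemma nc_triangle y x z : nc (x - z) <= nc (x - y) + nc (y - z).
Proof. by rewrite (_ : x - z = (x - y) + (y - z)) ?ncD //; ring. Qed.

Lemma ncM x y : nc (x * y) = nc x * nc y.
Proof. exact: Normc.normcM. Qed.

Lemma ncX z n : nc (z ^+ n) = nc z ^+ n.
Proof.
elim: n => [|n IH]; first by rewrite !expr0 Normc.normc1.
by rewrite !exprS ncM IH.
Qed.

Lemma nc_real (a : R) : nc (a%:C)%C = `|a|.
Proof. by rewrite /= expr0n addr0 sqrtr_sqr. Qed.

Lemma nc_nat n : nc n%:R = n%:R.
Proof. by rewrite -(rmorph_nat (@real_complex_def R (Phant R))) nc_real normr_nat. Qed.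

Lemma nc_sum (I : Type) (r : seq I) (P : pred I) (F : I -> R[i]) :
  nc (\sum_(i <- r | P i) F i) <= \sum_(i <- r | P i) nc (F i).
Proof.
elim/big_ind2: _ => //; first by rewrite Normc.normc0.
by move=> a b c d ab cd; rewrite (le_trans (ncD _ _)) // lerD.
Qed.

Lemma nc_eq0 z : nc z <= 0 -> z = 0.
Proof. by move=> z0; apply: Normc.eq0_normc; apply/eqP; rewrite eq_le z0 nc_ge0. Qed.

Lemma Re_le_nc z : `|complex.Re z| <= nc z.
Proof.
case: z => a b /=; rewrite -sqrtr_sqr ler_sqrt ?addr_ge0 ?sqr_ge0 //.
by rewrite lerDl sqr_ge0.
Qed.

Lemma Im_le_nc z : `|complex.Im z| <= nc z.
Proof.
case: z => a b /=; rewrite -sqrtr_sqr ler_sqrt ?addr_ge0 ?sqr_ge0 //.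
by rewrite lerDr sqr_ge0.
Qed.

Lemma nc_le_ReIm z : nc z <= `|complex.Re z| + `|complex.Im z|.
Proof.
case: z => a b; rewrite (_ : (a +i* b)%C = (a%:C + (0 +i* b))%C); last first.
  by rewrite /GRing.add /= addr0 add0r.
apply: le_trans (ncD _ _) _; rewrite nc_real /= addr0 add0r.
by rewrite expr0n add0r sqrtr_sqr.
Qed.

Lemma nc_imag (a : R) : nc (0 +i* a)%C = `|a|.
Proof. by rewrite /= expr0n add0r sqrtr_sqr. Qed.

Lemma ReD x y : complex.Re (x + y) = complex.Re x + complex.Re y.
Proof. by case: x; case: y. Qed.

Lemma ImD x y : complex.Im (x + y) = complex.Im x + complex.Im y.
Proof. by case: x; case: y. Qed.

Lemma ReN z : complex.Re (- z) = - complex.Re z.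
Proof. by case: z. Qed.

Lemma ImN z : complex.Im (- z) = - complex.Im z.
Proof. by case: z. Qed.

Lemma Re_sum (I : Type) (r : seq I) (P : pred I) (F : I -> R[i]) :
  complex.Re (\sum_(i <- r | P i) F i) = \sum_(i <- r | P i) complex.Re (F i).
Proof. by apply: (big_morph _ _ _) => // x y; exact: ReD. Qed.

Lemma Im_sum (I : Type) (r : seq I) (P : pred I) (F : I -> R[i]) :
  complex.Im (\sum_(i <- r | P i) F i) = \sum_(i <- r | P i) complex.Im (F i).
Proof. by apply: (big_morph _ _ _) => // x y; exact: ImD. Qed.

Lemma ReM x y :
  complex.Re (x * y) =
  complex.Re x * complex.Re y - complex.Im x * complex.Im y.
Proof. by case: x; case: y. Qed.

Lemma ImM x y :
  complex.Im (x * y) =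
  complex.Re x * complex.Im y + complex.Im x * complex.Re y.
Proof. by case: x; case: y. Qed.

Lemma Re_realM (r : R) z : complex.Re ((r%:C)%C * z) = r * complex.Re z.
Proof. by rewrite ReM /= mul0r subr0. Qed.

Lemma Im_realM (r : R) z : complex.Im ((r%:C)%C * z) = r * complex.Im z.
Proof. by rewrite ImM /= mul0r addr0. Qed.

Lemma complex_ext x y :
  complex.Re x = complex.Re y -> complex.Im x = complex.Im y -> x = y.
Proof. by case: x; case: y => a b c d /= -> ->. Qed.

Lemma nc_sqr z : nc z ^+ 2 = complex.Re z ^+ 2 + complex.Im z ^+ 2.
Proof. by case: z => a b /=; rewrite sqr_sqrtr ?addr_ge0 ?sqr_ge0. Qed.

End ComplexModulus.

(** * Series dominated by a geometric series of ratio 1/2 *)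

Section PowerSeries.
Context {R : realType}.
Local Notation nc := (@Normc.normc R).

(** The passage to the limit in the power series estimates: partial sums enter with an error
    [c / 2 ^+ n], which is then dropped. *)
Lemma le_of_geometric (x y c : R) : (forall n, x <= y + c / 2 ^+ n) -> x <= y.
Proof.
move=> H.
have c1 : (fun n => y + c / 2 ^+ n) @ \oo --> y.
  rewrite -[X in _ --> X]addr0; apply: cvgD; first exact: cvg_cst.
  rewrite (_ : (fun n => _) = geometric c 2^-1).
    by apply: cvg_geometric; rewrite ger0_norm; lra.
  by apply/funext => n; rewrite /geometric /= exprVn.
by apply: (ler_cvg_to (cvg_cst x) c1); apply: nearW.
Qed.

Lemma sum_half_tail (M : R) m n : 0 <= M -> (n <= m)%N ->
  \sum_(n <= i < m) M / 2 ^+ i <= 2 * M / 2 ^+ n.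
Proof.
move=> M0 nm.
suff -> : \sum_(n <= i < m) M / 2 ^+ i = 2 * M / 2 ^+ n - 2 * M / 2 ^+ m.
  by rewrite gerBl divr_ge0 ?mulr_ge0 ?exprn_ge0.
move: nm => /subnK <-; elim: (m - n)%N => [|k IH].
  by rewrite add0n big_geq // subrr.
rewrite addSn big_nat_recr /= ?leq_addl // IH exprS.
set u := 2 ^+ (k + n); have u0 : u != 0 by rewrite expf_neq0.
set v := 2 ^+ n; have v0 : v != 0 by rewrite expf_neq0.
by field; rewrite u0 v0.
Qed.

Lemma geometric_sum_limit_real (t : nat -> R) (M : R) :
  (forall i, `|t i| <= M / 2 ^+ i) ->
  exists l, forall n, `|l - \sum_(i < n) t i| <= 2 * M / 2 ^+ n.
Proof.
move=> tM.
have M0 : 0 <= M by have := le_trans (normr_ge0 _) (tM 0%N); rewrite expr0 divr1.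
have cs : cvgn (series t).
  apply: normed_cvg; apply: (series_le_cvg _ _ tM) => // [i|].
    by rewrite divr_ge0 ?exprn_ge0.
  have := @is_cvg_geometric_series R M 2^-1.
  rewrite /geometric /=; under eq_fun do rewrite exprVn.
  by apply; rewrite ger0_norm; lra.
exists (limn (series t)) => n.
have cl : (fun m => `|series t m - \sum_(i < n) t i|) @ \oo
    --> `|limn (series t) - \sum_(i < n) t i|.
  by apply: cvg_norm; apply: cvgB => //; exact: cvg_cst.
apply: (ler_cvg_to cl (cvg_cst _)); exists n => // m /= nm.
rewrite /series /= -(big_mkord xpredT t) (@big_cat_nat _ _ _ n) //= addrAC subrr add0r.
apply: le_trans (ler_norm_sum _ _ _) _.
by apply: le_trans (sum_half_tail M0 nm); apply: ler_sum.
Qed.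

Lemma geometric_partial_sums (t : nat -> R[i]) (M : R) n m : (n <= m)%N ->
  (forall i, nc (t i) <= M / 2 ^+ i) ->
  nc (\sum_(i < m) t i - \sum_(i < n) t i) <= 2 * M / 2 ^+ n.
Proof.
move=> nm tM.
have M0 : 0 <= M by have := le_trans (nc_ge0 _) (tM 0%N); rewrite expr0 divr1.
rewrite -!(big_mkord xpredT t) (@big_cat_nat _ _ _ n) //= addrAC subrr add0r.
apply: le_trans (nc_sum _ _ _) _.
by apply: le_trans (sum_half_tail M0 nm); apply: ler_sum.
Qed.

Lemma geometric_sum_limit (t : nat -> R[i]) (M : R) :
  (forall i, nc (t i) <= M / 2 ^+ i) ->
  exists l, forall n, nc (l - \sum_(i < n) t i) <= 2 * M / 2 ^+ n.
Proof.
move=> tM.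
have [a aP] := @geometric_sum_limit_real (fun i => complex.Re (t i)) M
  (fun i => le_trans (Re_le_nc _) (tM i)).
have [b bP] := @geometric_sum_limit_real (fun i => complex.Im (t i)) M
  (fun i => le_trans (Im_le_nc _) (tM i)).
exists (a +i* b)%C => n; apply: (@le_of_geometric _ _ (4 * M)) => k.
(* Adding the two real errors at n would give 4 M / 2 ^ n; taken at m >= k they vanish as k grows,
   so the constant stays 2 M. *)
pose m := maxn n k.
have nm : (n <= m)%N by rewrite leq_maxl.
have km : (k <= m)%N by rewrite leq_maxr.
have M0 : 0 <= M by have := le_trans (nc_ge0 _) (tM 0%N); rewrite expr0 divr1.
apply: le_trans (nc_triangle (\sum_(i < m) t i) _ _) _; rewrite addrC lerD //.
  exact: geometric_partial_sums.
apply: le_trans (nc_le_ReIm _) _.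
rewrite !ReD !ImD !ReN !ImN !Re_sum !Im_sum /=.
apply: le_trans (lerD (aP m) (bP m)) _.
rewrite -mulrDl (_ : 2 * M + 2 * M = 4 * M); last by ring.
rewrite ler_wpM2l ?mulr_ge0 // lef_pV2 ?posrE ?exprn_gt0 //.
by rewrite ler_weXn2l // ler1n.
Qed.

End PowerSeries.

(** * Local expansions, and derivatives with quadratic remainder *)

Section Expansions.
Context {R : realType}.
Local Notation nc := (@Normc.normc R).
Implicit Types (u g : R[i] -> R[i]) (z : R[i]) (a : nat -> R[i]).

(** The norm of [R[i]^o] takes its values in [R[i]], so balls have complex radii; a positive one is
    real because the order of [R[i]] only compares numbers with equal imaginary parts. *)
Lemma nbhs_complexP (A : set R[i]) z0 :
  nbhs (z0 : R[i]^o) A <->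
  exists2 e : R, 0 < e & forall z, nc (z - z0) < e -> A z.
Proof.
split.
  move=> /(@nbhs_normP _ R[i]^o z0 A)[e /= e0 eA].
  move: e0; rewrite ltcE /= => /andP[/eqP eIm eRe].
  exists (complex.Re e) => // z zz0; apply: eA => /=.
  rewrite -[e]RRe_real; last by rewrite realE lecE eIm eqxx /= ltW.
  by rewrite distrC (_ : `|_| = (nc (z - z0))%:C%C) // ltcR.
move=> [e e0 eA]; apply/(@nbhs_normP _ R[i]^o z0 A); exists (e%:C)%C; first by rewrite /= ltcR.
move=> z /=; rewrite distrC (_ : `|_| = (nc (z - z0))%:C%C) // ltcR.
exact: eA.
Qed.

Lemma cvg_complexP (s : nat -> R[i]) (l : R[i]) :
  (s : nat -> R[i]^o) @ \oo --> (l : R[i]^o) ->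
  forall e : R, 0 < e -> exists N, forall n, (N <= n)%N -> nc (s n - l) < e.
Proof.
move=> sl e e0.
have : nbhs (l : R[i]^o) [set z | nc (z - l) < e].
  by apply/nbhs_complexP; exists e.
by move=> /sl[N _ NP]; exists N => n Nn; exact: NP.
Qed.

Lemma power_term_bound a z z0 (rho B : R) : 0 < rho ->
  (forall n, nc (a n) * rho ^+ n <= B) -> nc (z - z0) <= rho / 2 ->
  forall i, nc (a i * (z - z0) ^+ i) <= B / 2 ^+ i.
Proof.
move=> rho0 aB zr i; rewrite ncM ncX ler_pdivlMr ?exprn_gt0 // -mulrA -exprMn.
apply: le_trans (aB i); rewrite ler_wpM2l ?nc_ge0 // lerXn2r ?nnegrE //.
- by rewrite mulr_ge0 ?nc_ge0.
- exact: ltW.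
- by rewrite -ler_pdivlMr.
Qed.

(* The factor 1/2 turns convergence on the disc of radius [rho] into the uniform
   geometric rate [2 B / 2 ^ n] on the disc of radius [rho / 2]. *)
Definition expands u z0 a (rho B : R) :=
  [/\ 0 < rho, forall n, nc (a n) * rho ^+ n <= B &
    forall z, nc (z - z0) <= rho / 2 -> forall n,
      nc (u z - \sum_(i < n) a i * (z - z0) ^+ i) <= 2 * B / 2 ^+ n].

Lemma expands_ge0 u z0 a rho B : expands u z0 a rho B -> 0 <= B.
Proof.
move=> [_ aB _]; apply: le_trans (aB 0%N).
by rewrite expr0 mulr1 nc_ge0.
Qed.

Lemma expands_at u z0 a rho B : expands u z0 a rho B -> u z0 = a 0%N.
Proof.
move=> uE; have B0 := expands_ge0 uE; have [rho0 _ uP] := uE.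
apply/eqP; rewrite -subr_eq0; apply/eqP/nc_eq0.
apply: (@le_of_geometric _ _ _ (2 * B)) => n; rewrite add0r.
have /uP/(_ n.+1) : nc (z0 - z0) <= rho / 2.
  by rewrite subrr Normc.normc0; lra.
rewrite big_ord_recl expr0 mulr1 big1 ?addr0 => [|i _].
  move=> /le_trans; apply.
  rewrite exprS invfM mulrA ler_wpM2r ?invr_ge0 ?exprn_ge0 //.
  lra.
by rewrite /= subrr exprS mul0r mulr0.
Qed.

(** Abel's lemma: convergence at the single point [z0 + r] bounds the terms [a n * r ^+ n], which
    dominates the series geometrically on the disc of radius r / 2. *)
Lemma analytic_at_expands u z0 :
  analytic_at u z0 -> exists a rho B, expands u z0 a rho B.
Proof.
move=> [a /nbhs_complexP[e e0 eP]].
have {}eP z : nc (z - z0) < e -> forall d : R, 0 < d -> exists N, forall n,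
    (N <= n)%N -> nc (\sum_(i < n) a i * (z - z0) ^+ i - u z) < d.
  move=> /eP/cvg_complexP zP d /zP[N NP]; exists N => n /NP.
  by rewrite /series /= big_mkord.
pose r := e / 2.
have r0 : 0 < r by rewrite /r; lra.
have [B BP] : exists B, forall n, nc (a n) * r ^+ n <= B.
  have z1 : nc (z0 + (r%:C)%C - z0) < e.
    by rewrite addrAC subrr add0r nc_real gtr0_norm // /r; lra.
  have [N NP] := eP _ z1 1 ltr01.
  (* From index N on, consecutive partial sums are within 1 of the limit, so a term is at most 2;
     the sum covers the earlier terms. *)
  exists (2 + \sum_(i < N) nc (a i) * r ^+ i) => n.
  have [nN|Nn] := ltnP n N.
    rewrite (bigD1 (Ordinal nN)) //= addrCA lerDl addr_ge0 // sumr_ge0 // => i _.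
    by rewrite mulr_ge0 ?nc_ge0 ?exprn_ge0 // ltW.
  apply: (@le_trans _ _ 2); last first.
    by rewrite lerDl sumr_ge0 // => i _; rewrite mulr_ge0 ?nc_ge0 ?exprn_ge0 // ltW.
  have : nc (a n * (z0 + (r%:C)%C - z0) ^+ n) <= 2.
    have := NP n.+1 (leqW Nn); have := NP n Nn.
    rewrite big_ord_recr /=; set S := \sum_(i < n) _; set t := _ * _.
    set v := u _; move=> S1 S2; rewrite (_ : t = (S + t - v) - (S - v)); last by ring.
    apply: le_trans (ncD _ _) _; rewrite ncN; lra.
  by rewrite ncM ncX addrAC subrr add0r nc_real gtr0_norm.
exists a, r, B; split => // z zr n.
have B0 : 0 <= B by apply: le_trans (BP 0%N); rewrite expr0 mulr1 nc_ge0.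
apply/ler_addgt0Pr => d d0.
have /eP/(_ d d0)[N NP] : nc (z - z0) < e by apply: le_lt_trans zr _; rewrite /r; lra.
have term := power_term_bound r0 BP zr.
apply: le_trans (nc_triangle (\sum_(i < maxn n N) a i * (z - z0) ^+ i) _ _) _.
rewrite ncB addrC lerD //.
  by apply: geometric_partial_sums term; exact: leq_maxl.
by apply/ltW/NP; exact: leq_maxr.
Qed.

(** One constant K bounds the remainder and, through its inverse, the radius where the bound holds.
    The property is thus monotone in K, as the compactness argument requires, and an estimate
    uniform in x can be integrated directly. *)
Definition isder_le (K : R) u z d :=
  forall h, nc h <= K^-1 -> nc (u (z + h) - u z - d * h) <= K * nc h ^+ 2.

Definition isder u z d := exists2 K : R, 0 < K & isder_le K u z d.

Lemma isder_le_trans (K L : R) u z d : 0 < K -> K <= L ->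
  isder_le K u z d -> isder_le L u z d.
Proof.
move=> K0 KL KP h hL; apply: le_trans (KP h _) _; last first.
  by rewrite ler_wpM2r ?exprn_ge0 ?nc_ge0.
by apply: le_trans hL _; rewrite lef_pV2 ?posrE // (lt_le_trans K0).
Qed.

Lemma isder_uniq u z d d' : isder u z d -> isder u z d' -> d = d'.
Proof.
move=> [K K0 KP] [L L0 LP]; apply/eqP; rewrite -subr_eq0; apply/eqP/nc_eq0.
pose M := K + L.
have M0 : 0 < M by rewrite addr_gt0.
apply: (@le_of_geometric _ _ _ 1) => n; rewrite add0r.
pose t : R := (M * 2 ^+ n)^-1.
have t0 : 0 < t by rewrite invr_gt0 mulr_gt0 ?exprn_gt0.
have tM : t <= M^-1.
  rewrite /t lef_pV2 ?posrE ?mulr_gt0 ?exprn_gt0 // ler_pMr //.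
  by rewrite exprn_ege1 // ler1n.
have nt : nc (t%:C)%C = t by rewrite nc_real gtr0_norm.
have /KP H1 : nc (t%:C)%C <= K^-1.
  by rewrite nt (le_trans tM) // lef_pV2 ?posrE // lerDl ltW.
have /LP H2 : nc (t%:C)%C <= L^-1.
  by rewrite nt (le_trans tM) // lef_pV2 ?posrE // lerDr ltW.
have : nc ((d - d') * (t%:C)%C) <= M * t ^+ 2.
  rewrite (_ : _ * _ = (u (z + (t%:C)%C) - u z - d' * (t%:C)%C) -
     (u (z + (t%:C)%C) - u z - d * (t%:C)%C)); last by ring.
  apply: le_trans (ncD _ _) _; rewrite ncN.
  apply: le_trans (lerD H2 H1) _.
  by rewrite nt /M mulrDl addrC.
rewrite ncM nt expr2 mulrA ler_pM2r // => /le_trans; apply.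
by rewrite /t invfM mulrA divff ?gt_eqF.
Qed.

(** Second-order Taylor estimate, with n ^ 2 for n (n - 1) / 2. The factor r ^ 2 on the left avoids
    the exponent n - 2 and a division by r. *)
Lemma pow_increment (w h : R[i]) (r : R) n : nc w <= r -> nc (w + h) <= r ->
  nc ((w + h) ^+ n - w ^+ n - n%:R * w ^+ n.-1 * h) * r ^+ 2 <=
  n%:R ^+ 2 * r ^+ n * nc h ^+ 2.
Proof.
move=> wr whr.
have r0 : 0 <= r by apply: le_trans wr; exact: nc_ge0.
elim: n => [|n IH].
  by rewrite !expr0 subrr sub0r !mul0r oppr0 Normc.normc0 expr0n !mul0r.
have E : (w + h) ^+ n.+1 - w ^+ n.+1 - n.+1%:R * w ^+ n * h =
   (w + h) * ((w + h) ^+ n - w ^+ n - n%:R * w ^+ n.-1 * h) +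
   n%:R * w ^+ n.-1 * h ^+ 2.
  case: n {IH} => [|n] /=; first by rewrite !expr0 !expr1; ring.
  by rewrite -!natr1 !exprS; ring.
rewrite /= E.
apply: (@le_trans _ _ (r * (n%:R ^+ 2 * r ^+ n * nc h ^+ 2) +
    n%:R * r ^+ n.+1 * nc h ^+ 2)).
  apply: (@le_trans _ _ ((r * nc ((w + h) ^+ n - w ^+ n - n%:R * w ^+ n.-1 * h) +
     n%:R * nc w ^+ n.-1 * nc h ^+ 2) * r ^+ 2)).
    rewrite ler_wpM2r ?exprn_ge0 //; apply: le_trans (ncD _ _) _.
    rewrite !ncM !ncX nc_nat lerD // ler_wpM2r ?nc_ge0 //.
  rewrite mulrDl -mulrA lerD ?ler_wpM2l //.
  case: n {IH E} => [|n] /=; first by rewrite !mul0r.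
  rewrite mulrAC ler_wpM2r ?exprn_ge0 ?nc_ge0 // -mulrA ler_wpM2l //.
  rewrite -(addn2 n) exprD ler_wpM2r ?exprn_ge0 //.
  by rewrite lerXn2r ?nnegrE ?nc_ge0.
rewrite (exprS r n) -subr_ge0.
rewrite (_ : _ - _ = (n%:R + 1) * r * r ^+ n * nc h ^+ 2); last first.
  by rewrite -[n.+1%:R]natr1; ring.
by rewrite !mulr_ge0 ?exprn_ge0 ?nc_ge0 ?addr_ge0.
Qed.

(** 6 is the sum of the whole series; the closed form in the proof gives its remainder exactly. *)
Lemma sum_sq_half n : \sum_(i < n) i%:R ^+ 2 / 2 ^+ i <= 6 :> R.
Proof.
suff -> : \sum_(i < n) i%:R ^+ 2 / 2 ^+ i =
    6 - 2 * (n%:R ^+ 2 + 2 * n%:R + 3) / 2 ^+ n :> R.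
  by rewrite gerBl divr_ge0 ?mulr_ge0 ?exprn_ge0 ?addr_ge0 ?mulr_ge0.
elim: n => [|n IH]; first by rewrite big_ord0 expr0; field.
rewrite big_ord_recr /= IH (exprS 2 n) -[n.+1%:R]natr1.
set p := 2 ^+ n; have p0 : p != 0 by rewrite expf_neq0.
by field.
Qed.

End Expansions.

(** * Termwise differentiation and isolated zeros *)

Section ComplexDerivative.
Context {R : realType}.
Local Notation nc := (@Normc.normc R).
Implicit Types (u v g : R[i] -> R[i]) (z : R[i]) (a b : nat -> R[i]).

Lemma expands_eq u v z0 a rho B :
  (forall z, nc (z - z0) <= rho / 2 -> u z = v z) ->
  expands u z0 a rho B -> expands v z0 a rho B.
Proof. by move=> uv [? ? uP]; split => // z zr n; rewrite -uv // uP. Qed.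

Lemma expands_weaken u z0 a rho rho' B B' : 0 < rho' -> rho' <= rho -> B <= B' ->
  expands u z0 a rho B -> expands u z0 a rho' B'.
Proof.
move=> r'0 r'r BB' [r0 aB uP]; split => // [n|z zr n].
  apply: le_trans BB'; apply: le_trans (aB n).
  by rewrite ler_wpM2l ?nc_ge0 // lerXn2r // nnegrE ltW.
apply: (@le_trans _ _ (2 * B / 2 ^+ n)); last first.
  by rewrite ler_wpM2r ?invr_ge0 ?exprn_ge0 // ler_wpM2l.
by apply: uP; apply: le_trans zr _; rewrite ler_wpM2r.
Qed.

Lemma expandsB u v z0 a b rho B rho' B' :
  expands u z0 a rho B -> expands v z0 b rho' B' ->
  expands (fun z => u z - v z) z0 (fun n => a n - b n) (Num.min rho rho') (B + B').
Proof.
move=> uE vE.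
have B0 := expands_ge0 uE; have B'0 := expands_ge0 vE.
have m0 : 0 < Num.min rho rho'.
  by case: uE vE => [r0 _ _] [r'0 _ _]; rewrite lt_min r0.
have {uE}[_ aB uP] : expands u z0 a (Num.min rho rho') B.
  by apply: expands_weaken uE => //; rewrite ge_min lexx.
have {vE}[_ bB vP] : expands v z0 b (Num.min rho rho') B'.
  by apply: expands_weaken vE => //; rewrite ge_min lexx orbT.
split => // [n|z zr n].
  apply: le_trans (lerD (aB n) (bB n)).
  rewrite -mulrDl ler_wpM2r ?exprn_ge0 ?(ltW m0) //.
  by apply: le_trans (ncD _ _) _; rewrite ncN.
rewrite mulrDr mulrDl; apply: le_trans (lerD (uP z zr n) (vP z zr n)).
under eq_bigr do rewrite mulrBl.
rewrite sumrB (_ : _ - _ = (u z - \sum_(i < n) a i * (z - z0) ^+ i) -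
  (v z - \sum_(i < n) b i * (z - z0) ^+ i)); last by ring.
by apply: le_trans (ncD _ _) _; rewrite ncN.
Qed.

Lemma expands_shift u z0 c a rho B :
  expands u (z0 + c) a rho B -> expands (fun z => u (z + c)) z0 a rho B.
Proof.
move=> [r0 aB uP]; split => // z zr n.
have E : z + c - (z0 + c) = z - z0 by ring.
by rewrite -E; apply: uP; rewrite E.
Qed.

Definition dcoef a := fun n => n.+1%:R * a n.+1.

(** Halving the radius absorbs the factor n + 1 of the differentiated series, since (n + 1) / 2 ^ n
    <= 1. The remainder is estimated on partial sums and n is sent to infinity; the constant K
    serves the whole disc of radius rho / 4. *)
Lemma expands_deriv u z0 a rho B : expands u z0 a rho B ->
  exists2 g, expands g z0 (dcoef a) (rho / 2) (B / rho) &
    exists2 K : R, 0 < K &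
      forall z, nc (z - z0) <= rho / 4 -> isder_le K u z (g z).
Proof.
move=> uE; have B0 := expands_ge0 uE; have [r0 aB uP] := uE.
have dB n : nc (dcoef a n) * (rho / 2) ^+ n <= B / rho.
  rewrite ler_pdivlMr // /dcoef ncM nc_nat.
  apply: le_trans (aB n.+1).
  have n2 : n.+1%:R / 2 ^+ n <= 1 :> R.
    by rewrite ler_pdivrMr ?exprn_gt0 // mul1r -natrX ler_nat ltn_expl.
  rewrite (_ : _ * rho = (n.+1%:R / 2 ^+ n) * (nc (a n.+1) * rho ^+ n.+1)).
    by rewrite ler_piMl // mulr_ge0 ?nc_ge0 ?exprn_ge0 ?ltW.
  by rewrite expr_div_n exprS; field; rewrite expf_neq0.
have term z i : nc (z - z0) <= rho / 4 ->
    nc (dcoef a i * (z - z0) ^+ i) <= (B / rho) / 2 ^+ i.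
  by move=> zr; apply: (power_term_bound _ dB); lra.
have /choice[g gP] : forall z, exists w : R[i], nc (z - z0) <= rho / 4 -> forall n,
    nc (w - \sum_(i < n) dcoef a i * (z - z0) ^+ i) <= 2 * (B / rho) / 2 ^+ n.
  move=> z; have [zr|zr] := pselect (nc (z - z0) <= rho / 4); last by exists 0.
  by have [l lP] := geometric_sum_limit (fun i => term z i zr); exists l.
exists g; first split => // [|z zr n]; first by lra.
  by apply: gP; move: zr; lra.
(* The first summand of K is the remainder bound from [pow_increment] and [sum_sq_half]; the second
   gives K^-1 <= rho / 4, so that z + h stays in the disc of radius rho / 2 where u is expanded. *)
pose r := rho / 2; pose K := 6 * B / r ^+ 2 + 4 / rho.
have rr0 : 0 < r by rewrite /r; lra.
have K1 : 0 <= 6 * B / r ^+ 2 by rewrite divr_ge0 ?mulr_ge0 ?exprn_ge0 // ltW.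
have K2 : 0 < 4 / rho by rewrite divr_gt0.
exists K; first by rewrite /K; lra.
move=> z zr h hK.
have hr : nc h <= rho / 4.
  apply: le_trans hK _; rewrite -[rho / 4]invrK lef_pV2 ?posrE ?invr_gt0 ?invf_div //.
  - by rewrite /K; lra.
  - by rewrite /K; lra.
  - lra.
pose w := z - z0.
have wr : nc w <= r by rewrite /w /r; move: zr; lra.
have whr : nc (w + h) <= r.
  apply: le_trans (ncD _ _) _; move: zr hr; rewrite /w /r; lra.
apply: (@le_trans _ _ (6 * B / r ^+ 2 * nc h ^+ 2)); last first.
  by rewrite ler_wpM2r ?exprn_ge0 ?nc_ge0 // /K; lra.
apply: (@le_of_geometric _ _ _ (4 * B + 2 * (B / rho) * nc h)) => n.
pose P := \sum_(i < n.+1) a i * (w + h) ^+ i.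
pose Q := \sum_(i < n.+1) a i * w ^+ i.
pose D := \sum_(i < n) dcoef a i * w ^+ i.
have E1 : P - Q - D * h =
    \sum_(i < n.+1) a i * ((w + h) ^+ i - w ^+ i - i%:R * w ^+ i.-1 * h).
  rewrite /P /Q /D mulr_suml -sumrB.
  rewrite [RHS](eq_bigr (fun i : 'I_n.+1 => (a i * (w + h) ^+ i - a i * w ^+ i) -
      a i * i%:R * w ^+ i.-1 * h)); last by move=> i _; ring.
  rewrite [RHS]sumrB; congr (_ - _).
  rewrite [RHS]big_ord_recl mulr0 !mul0r add0r; apply: eq_bigr => i _.
  by rewrite /dcoef lift0 /=; ring.
have H1 : nc (P - Q - D * h) <= 6 * B / r ^+ 2 * nc h ^+ 2.
  rewrite E1; apply: le_trans (nc_sum _ _ _) _.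
  apply: (@le_trans _ _ (\sum_(i < n.+1)
      i%:R ^+ 2 / 2 ^+ i * (B * nc h ^+ 2 / r ^+ 2))).
    apply: ler_sum => i _; rewrite ncM.
    apply: (@le_trans _ _ (nc (a i) * (i%:R ^+ 2 * r ^+ i * nc h ^+ 2 / r ^+ 2))).
      rewrite ler_wpM2l ?nc_ge0 // ler_pdivlMr ?exprn_gt0 //.
      exact: pow_increment.
    rewrite (_ : nc (a i) * _ = (nc (a i) * rho ^+ i) *
        (i%:R ^+ 2 / 2 ^+ i * (nc h ^+ 2 / r ^+ 2))); last first.
      by rewrite [r ^+ i]expr_div_n; ring.
    rewrite (_ : i%:R ^+ 2 / 2 ^+ i * (B * _ / _) =
        B * (i%:R ^+ 2 / 2 ^+ i * (nc h ^+ 2 / r ^+ 2))); last by ring.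
    rewrite ler_wpM2r // !(mulr_ge0, exprn_ge0, invr_ge0, nc_ge0) ?ler0n ?(ltW r0) ?(ltW rr0) //.
  rewrite -mulr_suml (_ : 6 * B / _ * _ = 6 * (B * nc h ^+ 2 / r ^+ 2)); last by ring.
  rewrite ler_wpM2r ?sum_sq_half //.
  by rewrite !(mulr_ge0, exprn_ge0, invr_ge0, nc_ge0) ?(ltW r0) ?(ltW rr0).
have H2 : nc (u (z + h) - P) <= 2 * B / 2 ^+ n.+1.
  have wh : w + h = z + h - z0 by rewrite /w; ring.
  by rewrite /P wh; apply: uP; rewrite -wh.
have H3 : nc (u z - Q) <= 2 * B / 2 ^+ n.+1 by exact: uP.
have H4 := gP z zr n.
rewrite (_ : _ - _ - _ = (P - Q - D * h) +
  ((u (z + h) - P) - (u z - Q) - (g z - D) * h)); last by ring.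
apply: le_trans (ncD _ _) _; rewrite lerD //.
apply: le_trans (ncD _ _) _; rewrite ncN [X in _ <= X]mulrDl lerD //.
  apply: le_trans (ncD _ _) _; rewrite ncN; apply: le_trans (lerD H2 H3) _.
  rewrite -mulrDl (_ : 2 * B + 2 * B = 4 * B); last by ring.
  rewrite ler_wpM2l ?mulr_ge0 // lef_pV2 ?posrE ?exprn_gt0 //.
  by rewrite ler_weXn2l // ler1n.
by rewrite ncM mulrAC ler_wpM2r ?nc_ge0.
Qed.

(* [cder u z] is 0 where u has no derivative. *)
Definition cder u z : R[i] := xget 0 [set d | isder u z d].

Lemma cderE u z d : isder u z d -> cder u z = d.
Proof.
move=> ud; apply: (@isder_uniq _ u z _ _ _ ud).
by apply: (@xgetPex _ 0 [set d | isder u z d]); exists d.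
Qed.

Lemma expands_cder u z0 a rho B : expands u z0 a rho B ->
  expands (cder u) z0 (dcoef a) (rho / 2) (B / rho).
Proof.
move=> /expands_deriv[g gE [K K0 gP]]; apply: expands_eq gE => z zr.
by rewrite (@cderE u z (g z)) //; exists K => //; apply: gP; move: zr; lra.
Qed.

Lemma expands_isder_le u z0 a rho B : expands u z0 a rho B ->
  exists2 K : R, 0 < K &
    forall z, nc (z - z0) <= rho / 4 -> isder_le K u z (cder u z).
Proof.
move=> /expands_deriv[g _ [K K0 gP]]; exists K => // z zr.
by rewrite (@cderE u z (g z)); [exact: gP | exists K => //; exact: gP].
Qed.

Lemma expands_isder u z0 a rho B : expands u z0 a rho B ->
  isder u z0 (cder u z0).
Proof.
move=> uE; have [r0 _ _] := uE; have [K K0 KP] := expands_isder_le uE.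
by exists K => //; apply: KP; rewrite subrr Normc.normc0; lra.
Qed.

Lemma expands_iter_cder u z0 a rho B j : expands u z0 a rho B ->
  exists rho' B', expands (iter j cder u) z0 (iter j dcoef a) rho' B'.
Proof.
move=> uE; elim: j => [|j [rho' [B' IH]]]; first by exists rho, B.
by exists (rho' / 2), (B' / rho'); apply: expands_cder.
Qed.

(** At n = 0 this is j! a_j, which turns equality of all derivatives at two points into equality of
    the coefficients. *)
Lemma iter_dcoef a j n : iter j dcoef a n = ((n + j) ^_ j)%:R * a (n + j)%N.
Proof.
elim: j n => [|j IH] n; first by rewrite addn0 ffactn0 mul1r.
by rewrite iterS /dcoef IH mulrA -natrM -(addSnnS n j) ffactnSr addnK mulnC.
Qed.

(** If a_m is the first nonzero coefficient, a zero z makes a_m (z - z0)^m equal, up to sign, to the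
    sum of the later terms, which is O(|z - z0|^(m + 1)); this is impossible close to z0. *)
Lemma expands_isolated_zero u z0 a rho B : expands u z0 a rho B ->
  (forall z, nc (z - z0) <= rho / 2 -> u z = 0) \/
  (exists2 e : R, 0 < e & forall z, 0 < nc (z - z0) < e -> u z != 0).
Proof.
move=> uE; have [r0 aB uP] := uE.
have [a0|/existsNP[m0 /eqP am0]] := pselect (forall n, a n = 0).
  left => z zr; apply: nc_eq0; apply: (@le_of_geometric _ _ _ (2 * B)) => n.
  have := uP z zr n; rewrite big1 ?subr0 ?add0r // => i _.
  by rewrite a0 mul0r.
right.
have exm : exists m, a m != 0 by exists m0.
case: (ex_minnP exm) => m am mmin.
have aim i : (i < m)%N -> a i = 0.
  by move=> im; apply/eqP; apply: contraTT im => /mmin; rewrite -leqNgt.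
have am_gt0 : 0 < nc (a m).
  by rewrite lt_neqAle nc_ge0 andbT eq_sym; apply: contra_neq am => /Normc.eq0_normc.
have B0 : 0 < B.
  by apply: lt_le_trans (aB m); rewrite mulr_gt0 ?exprn_gt0.
(* The second entry is the value of |z - z0| below which 2 M, the bound on the later terms, is
   smaller than the m-th term. *)
pose e := Num.min (rho / 2) (nc (a m) * rho ^+ m * rho / (2 * 2 ^+ m.+1 * B)).
exists e.
  rewrite lt_min divr_gt0 //= divr_gt0 // !mulr_gt0 ?exprn_gt0 //.
move=> z /andP[z0' ze]; apply/eqP => uz0.
have zr : nc (z - z0) <= rho / 2.
  by apply/ltW/(lt_le_trans ze); rewrite ge_min lexx.
pose t := nc (z - z0) / rho.
have t0 : 0 < t by rewrite divr_gt0.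
have t2 : t <= 2^-1 by rewrite ler_pdivrMr // mulrC.
pose M := B * t ^+ m.+1 * 2 ^+ m.+1.
have aw i : nc (a i * (z - z0) ^+ i) <= B * t ^+ i.
  rewrite ncM ncX (_ : nc (z - z0) = t * rho); last by rewrite /t divfK ?gt_eqF.
  by rewrite exprMn mulrCA mulrC ler_wpM2r ?exprn_ge0 // ltW.
(* Without its m-th term the series has the majorant M / 2 ^ i: for i > m, t <= 1/2 gives t ^ i <= t
   ^ (m + 1) / 2 ^ (i - m - 1). *)
pose s i := if i == m then 0 else a i * (z - z0) ^+ i.
have sM i : nc (s i) <= M / 2 ^+ i.
  have M0 : 0 <= M / 2 ^+ i.
    by rewrite !mulr_ge0 ?exprn_ge0 ?invr_ge0 ?exprn_ge0 ?(ltW t0) ?(ltW B0).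
  rewrite /s; case: ltngtP => im; rewrite ?Normc.normc0 //.
    by rewrite aim // mul0r Normc.normc0.
  apply: le_trans (aw i) _; rewrite /M -mulrA -mulrA ler_wpM2l ?(ltW B0) //.
  rewrite -(subnK im) [t ^+ _]exprD mulrC ler_wpM2l ?exprn_ge0 ?(ltW t0) //.
  rewrite [2 ^+ (_ + _)]exprD invfM mulrCA divff ?expf_neq0 // mulr1.
  by rewrite -exprVn lerXn2r // nnegrE ?invr_ge0 // ltW.
have H : nc (a m * (z - z0) ^+ m) <= 2 * M.
  apply: (@le_of_geometric _ _ _ (2 * B)) => n.
  pose k := maxn n m.+1.
  have mk : (m < k)%N by rewrite leq_maxr.
  have := uP z zr k; rewrite uz0 sub0r ncN => H1.
  have := geometric_partial_sums (leq0n k) sM.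
  rewrite big_ord0 subr0 expr0 divr1 => H2.
  have E : a m * (z - z0) ^+ m = (\sum_(i < k) a i * (z - z0) ^+ i) - \sum_(i < k) s i.
    rewrite -sumrB (bigD1 (Ordinal mk)) //= /s eqxx subr0 big1 ?addr0 // => i.
    rewrite -val_eqE /= => /negbTE ->; exact: subrr.
  rewrite E; apply: le_trans (ncD _ _) _; rewrite ncN addrC lerD //.
  apply: le_trans H1 _; rewrite ler_wpM2l ?mulr_ge0 ?(ltW B0) //.
  rewrite lef_pV2 ?posrE ?exprn_gt0 // ler_weXn2l ?ler1n //.
  exact: leq_maxl.
move: H; rewrite ncM ncX (_ : nc (z - z0) = t * rho); last by rewrite /t divfK ?gt_eqF.
rewrite exprMn /M exprS.
have -> : nc (a m) * (t ^+ m * rho ^+ m) = t ^+ m * (nc (a m) * rho ^+ m) by ring.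
have -> : 2 * (B * (t * t ^+ m) * 2 ^+ m.+1) = t ^+ m * (2 * 2 ^+ m.+1 * B * t) by ring.
rewrite ler_pM2l ?exprn_gt0 // leNgt => /negP; apply.
have : nc (z - z0) < nc (a m) * rho ^+ m * rho / (2 * 2 ^+ m.+1 * B).
  by apply: lt_le_trans ze _; rewrite ge_min lexx orbT.
rewrite ltr_pdivlMr ?mulr_gt0 ?exprn_gt0 // mulrC => H.
by rewrite /t mulrA ltr_pdivrMr.
Qed.

End ComplexDerivative.

(** * Complex-valued functions of a real variable *)

Section RealVariable.
Context {R : realType}.
Local Notation nc := (@Normc.normc R).
Local Notation mu := (@lebesgue_measure R).
Implicit Types (u v : R -> R[i]) (a b x w : R).

Lemma is_derive_quadratic (phi : R -> R) x d (K : R) : 0 < K ->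
  (forall h, `|h| <= K^-1 -> `|phi (x + h) - phi x - d * h| <= K * h ^+ 2) ->
  is_derive x 1 phi d.
Proof.
move=> K0 KP.
have cv : (fun h => h^-1 *: ((phi \o shift x) (h *: 1) - phi x)) @ 0^' --> d.
  apply/cvgrPdist_le => /= e e0.
  near=> h.
  have h0 : h != 0 by near: h; exact: nbhs_dnbhs_neq.
  have hK : `|h| <= K^-1.
    near: h; apply: dnbhs0_le; by rewrite invr_gt0.
  have he : `|h| <= e / K.
    near: h; apply: dnbhs0_le; by rewrite divr_gt0.
  rewrite [h *: 1]mulr1 /= [h + x]addrC.
  have := KP h hK; rewrite -(ler_pM2l (_ : 0 < `|h^-1|)) ?normr_gt0 ?invr_neq0 //.
  rewrite -normrM distrC (_ : h^-1 * _ = h^-1 *: (phi (x + h) - phi x) - d); last first.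
    by rewrite /GRing.scale /=; field.
  move=> /le_trans; apply.
  rewrite normfV mulrCA -real_normK ?num_real // expr2 mulKf ?normr_eq0 //.
  by rewrite mulrC -ler_pdivlMr.
apply: DeriveDef; first by apply/cvg_ex; exists d.
exact/cvg_lim.
Unshelve. all: by end_near. Qed.

(** Real and imaginary parts are treated separately, as in [cintegral], so that the real theorems on
    continuity, derivatives and integrals apply. *)
Definition ccont_at u x :=
  {for x, continuous (fun t => complex.Re (u t))} /\
  {for x, continuous (fun t => complex.Im (u t))}.

Definition cder_at u x (d : R[i]) :=
  is_derive x 1 (fun t => complex.Re (u t)) (complex.Re d) /\
  is_derive x 1 (fun t => complex.Im (u t)) (complex.Im d).

(** Continuity is two-sided even at a and b, which is available for f because it is expanded in full
    discs around boundary points. *)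
Definition ccont a b u := forall x, a <= x <= b -> ccont_at u x.

Lemma is_derive_continuous (phi : R -> R) x d :
  is_derive x 1 phi d -> {for x, continuous phi}.
Proof.
move=> [df _]; apply: differentiable_continuous.
exact/derivable1_diffP.
Qed.

Lemma cder_ccont_at u x d : cder_at u x d -> ccont_at u x.
Proof. by move=> [/is_derive_continuous ? /is_derive_continuous ?]. Qed.

Lemma ccont_atM u v x : ccont_at u x -> ccont_at v x ->
  ccont_at (fun t => u t * v t) x.
Proof.
move=> [u1 u2] [v1 v2]; split.
  rewrite (_ : (fun t => _) = (fun t => complex.Re (u t) * complex.Re (v t) -
      complex.Im (u t) * complex.Im (v t))); last by apply/funext => t; rewrite ReM.
  by apply: cvgB; apply: cvgM.
rewrite (_ : (fun t => _) = (fun t => complex.Re (u t) * complex.Im (v t) +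
    complex.Im (u t) * complex.Re (v t))); last by apply/funext => t; rewrite ImM.
by apply: cvgD; apply: cvgM.
Qed.

Lemma ccont_atD u v x : ccont_at u x -> ccont_at v x ->
  ccont_at (fun t => u t + v t) x.
Proof.
move=> [u1 u2] [v1 v2]; split.
  rewrite (_ : (fun t => _) = (fun t => complex.Re (u t) + complex.Re (v t)));
      last by apply/funext => t; rewrite ReD.
  exact: cvgD.
rewrite (_ : (fun t => _) = (fun t => complex.Im (u t) + complex.Im (v t)));
    last by apply/funext => t; rewrite ImD.
exact: cvgD.
Qed.

Lemma ccont_at_cst c x : ccont_at (fun=> c) x.
Proof. by split; exact: cvg_cst. Qed.

Lemma ccont_atB u v x : ccont_at u x -> ccont_at v x ->
  ccont_at (fun t => u t - v t) x.
Proof.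
move=> [u1 u2] [v1 v2]; split.
  rewrite (_ : (fun t => _) = (fun t => complex.Re (u t) - complex.Re (v t)));
      last by apply/funext => t; rewrite ReD ReN.
  exact: cvgB.
rewrite (_ : (fun t => _) = (fun t => complex.Im (u t) - complex.Im (v t)));
    last by apply/funext => t; rewrite ImD ImN.
exact: cvgB.
Qed.

Lemma ccont_at_sum n (u : 'I_n -> R -> R[i]) x :
  (forall i, ccont_at (u i) x) -> ccont_at (fun t => \sum_(i < n) u i t) x.
Proof.
elim: n u => [|n IH] u H.
  rewrite (_ : (fun t => _) = fun=> 0); first exact: ccont_at_cst.
  by apply/funext => t; rewrite big_ord0.
rewrite (_ : (fun t => _) = fun t => u ord0 t + \sum_(i < n) u (lift ord0 i) t).
  by apply: ccont_atD => //; apply: IH.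
by apply/funext => t; rewrite big_ord_recl.
Qed.

Lemma cder_atM u v x d e : cder_at u x d -> cder_at v x e ->
  cder_at (fun t => u t * v t) x (u x * e + d * v x).
Proof.
move=> [u1 u2] [v1 v2]; split.
  rewrite (_ : (fun t => _) = ((fun t => complex.Re (u t)) * (fun t => complex.Re (v t)) -
      (fun t => complex.Im (u t)) * (fun t => complex.Im (v t))));
    last by apply/funext => t; rewrite ReM.
  apply: is_derive_eq; rewrite !ReD !ReM /GRing.scale /=; ring.
rewrite (_ : (fun t => _) = ((fun t => complex.Re (u t)) * (fun t => complex.Im (v t)) +
    (fun t => complex.Im (u t)) * (fun t => complex.Re (v t))));
  last by apply/funext => t; rewrite ImM.
apply: is_derive_eq; rewrite !ImD !ImM /GRing.scale /=; ring.
Qed.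

Lemma cder_at_cst c x : cder_at (fun=> c) x 0.
Proof. by split; exact: is_derive_cst. Qed.

Lemma expiD x y : expi (x + y) = expi x * expi y :> R[i].
Proof.
apply: complex_ext; rewrite ?ReM ?ImM /= ?cosD ?sinD //.
by rewrite addrC.
Qed.

Lemma expi0 : expi 0 = 1 :> R[i].
Proof. by rewrite /expi cos0 sin0. Qed.

Lemma expiN_mul x : expi (- x) * expi x = 1 :> R[i].
Proof. by rewrite -expiD addNr expi0. Qed.

Lemma nc_expi x : nc (expi x) = 1.
Proof. by rewrite /expi /= cos2Dsin2 sqrtr1. Qed.

Lemma expi_2pi_int (k : int) : expi (2 * pi * k%:~R) = 1 :> R[i].
Proof.
have nat_case n : expi (2 * pi * n%:R) = 1 :> R[i].
  elim: n => [|n IH]; first by rewrite mulr0 expi0.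
  rewrite -[n.+1%:R]natr1 mulrDr expiD IH mul1r mulr1 mulrC mulr_natr.
  by rewrite /expi cos2pi sin2pi.
case: k => n; first exact: nat_case.
rewrite NegzE mulrNz mulrN; have := expiN_mul (2 * pi * n.+1%:R).
by rewrite -[n.+1%:~R]/(n.+1%:R) nat_case mulr1.
Qed.

Lemma cder_at_expi w x :
  cder_at (fun t => expi (w * t)) x ((0 +i* w)%C * expi (w * x)).
Proof.
have lin : is_derive x 1 (fun t => w * t) w.
  rewrite (_ : (fun t => _) = w \*: id); last by apply/funext.
  by apply: is_derive_eq; rewrite /GRing.scale /= mulr1.
split => /=.
  rewrite (_ : (fun t => _) = cos \o (fun t => w * t)) //.
  by apply: is_derive_eq; rewrite /= ?mul0r; ring.
rewrite (_ : (fun t => _) = sin \o (fun t => w * t)) //.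
by apply: is_derive_eq; rewrite /= ?mul0r; ring.
Qed.

Lemma ccont_at_expi w x : ccont_at (fun t => expi (w * t)) x.
Proof. exact: cder_ccont_at (cder_at_expi w x). Qed.

Lemma continuous_itv_within (phi : R -> R) a b :
  (forall x, a <= x <= b -> {for x, continuous phi}) ->
  {within `[a, b], continuous phi}.
Proof.
move=> H; apply: continuous_in_subspaceT => x; rewrite inE /= in_itv /=.
exact: H.
Qed.

Lemma continuous_itv_integrable (phi : R -> R) a b :
  (forall x, a <= x <= b -> {for x, continuous phi}) ->
  mu.-integrable `[a, b] (EFin \o phi).
Proof.
move=> H; apply: continuous_compact_integrable; first exact: segment_compact.
exact: continuous_itv_within.
Qed.

Lemma ccont_Re a b u : ccont a b u ->
  mu.-integrable `[a, b] (EFin \o (fun x => complex.Re (u x))).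
Proof. by move=> H; apply: continuous_itv_integrable => x /H[]. Qed.

Lemma ccont_Im a b u : ccont a b u ->
  mu.-integrable `[a, b] (EFin \o (fun x => complex.Im (u x))).
Proof. by move=> H; apply: continuous_itv_integrable => x /H[]. Qed.

Local Notation ci a b u := (@cintegral R `[a, b] u).

Lemma eq_ci a b u v : (forall x, a <= x <= b -> u x = v x) ->
  ci a b u = ci a b v.
Proof.
move=> uv; rewrite /cintegral; congr (_ +i* _)%C; apply: eq_Rintegral => x;
  by rewrite inE /= in_itv /= => /uv ->.
Qed.

Lemma ciD a b u v : ccont a b u -> ccont a b v ->
  ci a b (fun x => u x + v x) = ci a b u + ci a b v.
Proof.
move=> cu cv; apply: complex_ext; rewrite ?ReD ?ImD /=.
  under eq_Rintegral do rewrite ReD.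
  by rewrite RintegralD //; exact: ccont_Re.
under eq_Rintegral do rewrite ImD.
by rewrite RintegralD //; exact: ccont_Im.
Qed.

Lemma RintegralZl_itv (phi : R -> R) a b r :
  mu.-integrable `[a, b] (EFin \o phi) ->
  \int[mu]_(x in `[a, b]) (r * phi x) = r * \int[mu]_(x in `[a, b]) phi x.
Proof. by move=> ?; rewrite RintegralZl. Qed.

Lemma integrableZl_itv (phi : R -> R) a b r :
  mu.-integrable `[a, b] (EFin \o phi) ->
  mu.-integrable `[a, b] (EFin \o (fun x => r * phi x)).
Proof.
move=> iphi; rewrite (_ : _ \o _ = (fun x => r%:E * (EFin \o phi) x)%E) //.
exact: integrableZl.
Qed.

Lemma integrableD_itv (phi psi : R -> R) a b :
  mu.-integrable `[a, b] (EFin \o phi) -> mu.-integrable `[a, b] (EFin \o psi) ->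
  mu.-integrable `[a, b] (EFin \o (fun x => phi x + psi x)).
Proof.
move=> ? ?; rewrite (_ : _ \o _ = ((EFin \o phi) \+ (EFin \o psi))%E) //.
exact: integrableD.
Qed.

Lemma integrableB_itv (phi psi : R -> R) a b :
  mu.-integrable `[a, b] (EFin \o phi) -> mu.-integrable `[a, b] (EFin \o psi) ->
  mu.-integrable `[a, b] (EFin \o (fun x => phi x - psi x)).
Proof.
move=> ? ?; rewrite (_ : _ \o _ = ((EFin \o phi) \- (EFin \o psi))%E) //.
exact: integrableB.
Qed.

Lemma ciZ a b c u : ccont a b u -> ci a b (fun x => c * u x) = c * ci a b u.
Proof.
move=> cu; have [r1 r2] := (ccont_Re cu, ccont_Im cu).
apply: complex_ext; rewrite ?ReM ?ImM /=.
  under eq_Rintegral do rewrite ReM.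
  by rewrite RintegralB ?RintegralZl_itv //; exact: integrableZl_itv.
under eq_Rintegral do rewrite ImM.
by rewrite RintegralD ?RintegralZl_itv //; exact: integrableZl_itv.
Qed.

Lemma ciB a b u v : ccont a b u -> ccont a b v ->
  ci a b (fun x => u x - v x) = ci a b u - ci a b v.
Proof.
move=> cu cv; rewrite -[- ci a b v]mulN1r -ciZ // -ciD //.
  by apply: eq_ci => x _; rewrite mulN1r.
by move=> x xab; apply: ccont_atM (cv _ xab); exact: ccont_at_cst.
Qed.

Lemma Rintegral_FTC2 (phi Phi : R -> R) a b : a <= b ->
  (forall x, a <= x <= b -> {for x, continuous phi}) ->
  (forall x, a <= x <= b -> is_derive x 1 Phi (phi x)) ->
  \int[mu]_(x in `[a, b]) phi x = Phi b - Phi a.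
Proof.
rewrite le_eqVlt => /predU1P[<- _ _|ab cphi dPhi].
  by rewrite set_itv1 Rintegral_set1 subrr.
rewrite /Rintegral (@continuous_FTC2 _ phi Phi) //.
- exact: continuous_itv_within.
- have cPhi x : a <= x <= b -> {for x, continuous Phi}.
    by move=> /dPhi/is_derive_continuous.
  split.
  + move=> x; rewrite in_itv /= => /andP[ax xb].
    by have [] : is_derive x 1 Phi (phi x) by apply: dPhi; rewrite !ltW.
  + by apply: cvg_at_right_filter; apply: cPhi; rewrite lexx ltW.
  + by apply: cvg_at_left_filter; apply: cPhi; rewrite lexx ltW.
- move=> x; rewrite in_itv /= => /andP[ax xb].
  rewrite derive1E; apply: derive_val.
  by apply: dPhi; rewrite !ltW.
Qed.

Lemma ci_FTC2 a b u v : a <= b -> ccont a b u ->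
  (forall x, a <= x <= b -> cder_at v x (u x)) -> ci a b u = v b - v a.
Proof.
move=> ab cu dv; apply: complex_ext; rewrite ?ReD ?ImD ?ReN ?ImN /=.
  by apply: (@Rintegral_FTC2 _ (fun x => complex.Re (v x))) => // [x /cu[]|x /dv[]].
by apply: (@Rintegral_FTC2 _ (fun x => complex.Im (v x))) => // [x /cu[]|x /dv[]].
Qed.

Lemma Rintegral_cst_itv a b M : a <= b ->
  \int[mu]_(x in `[a, b]) M = M * (b - a).
Proof.
move=> ab; rewrite mulrBr.
apply: (@Rintegral_FTC2 (fun=> M) (fun x => M * x)) => // x _.
  exact: cvg_cst.
rewrite (_ : (fun t => _) = M \*: id); last by apply/funext.
by apply: is_derive_eq; rewrite /GRing.scale /= mulr1.
Qed.

Lemma ci_cst a b c : a <= b -> ci a b (fun=> c) = ((b - a)%:C)%C * c.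
Proof.
move=> ab; rewrite /cintegral !Rintegral_cst_itv //.
by apply: complex_ext; rewrite ?ReM ?ImM /=; ring.
Qed.

(** The factor 2 is the price of bounding real and imaginary parts separately; it is the 2 of the
    bound 2 M on coefficients and makes the error of a mode 4 T. *)
Lemma ci_bound a b u M : a <= b -> ccont a b u ->
  (forall x, a <= x <= b -> nc (u x) <= M) ->
  nc (ci a b u) <= 2 * (M * (b - a)).
Proof.
move=> ab cu uM.
have real_bound phi : mu.-integrable `[a, b] (EFin \o phi) ->
    (forall x, a <= x <= b -> `|phi x| <= M) ->
    `|\int[mu]_(x in `[a, b]) phi x| <= M * (b - a).
  move=> iphi phiM; apply: le_trans (le_normr_Rintegral _ iphi) _ => //.
  rewrite -(Rintegral_cst_itv M ab); apply: le_Rintegral => //; last first.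
    by apply: continuous_itv_integrable => x _; exact: cvg_cst.
  exact: (integrable_norm iphi).
apply: le_trans (nc_le_ReIm _) _; rewrite mulr_natl mulr2n lerD //=.
  apply: real_bound => [|x /uM]; first exact: ccont_Re.
  by apply: le_trans; exact: Re_le_nc.
apply: real_bound => [|x /uM]; first exact: ccont_Im.
by apply: le_trans; exact: Im_le_nc.
Qed.

End RealVariable.
Notation ci a b u := (cintegral `[a, b] u).

(** * Fourier series *)

Section FourierSeries.
Context {R : realType}.
Variable T : R.
Hypothesis T0 : 0 < T.
Local Notation nc := (@Normc.normc R).
Local Notation mu := (@lebesgue_measure R).
Implicit Types (u h : R -> R[i]) (k l : int) (n m : nat).

Definition fexp k (x : R) : R[i] := expi (omega T k%:~R * x).

Lemma fexpD k l x : fexp (k + l) x = fexp k x * fexp l x.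
Proof.
rewrite /fexp -expiD -mulrDl; congr (expi (_ * _)).
by rewrite /omega intrD; field; rewrite gt_eqF.
Qed.

Lemma fexp0 x : fexp 0 x = 1.
Proof. by rewrite /fexp /omega mulr0 !mul0r expi0. Qed.

Lemma fexp_at0 k : fexp k 0 = 1.
Proof. by rewrite /fexp mulr0 expi0. Qed.

Lemma fexpN_mul k x : fexp (- k) x * fexp k x = 1.
Proof. by rewrite -fexpD addNr fexp0. Qed.

Lemma fexp_atT k : fexp k T = 1.
Proof.
rewrite /fexp /omega divfK ?gt_eqF //; exact: expi_2pi_int.
Qed.

Lemma nc_fexp k x : nc (fexp k x) = 1.
Proof. exact: nc_expi. Qed.

Lemma fexpB k x y : fexp k (x - y) = fexp k x * fexp (- k) y.
Proof.
rewrite /fexp -expiD; congr expi.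
by rewrite /omega intrN; field; rewrite gt_eqF.
Qed.

Lemma ccont_at_fexp k x : ccont_at (fexp k) x.
Proof. exact: ccont_at_expi. Qed.

Lemma cder_at_fexp k x :
  cder_at (fexp k) x ((0 +i* omega T k%:~R)%C * fexp k x).
Proof. exact: cder_at_expi. Qed.

Lemma omega_neq0 k : k != 0 -> omega T k%:~R != 0 :> R.
Proof.
move=> k0; rewrite /omega !mulf_neq0 ?invr_neq0 ?intr_eq0 //.
- by rewrite gt_eqF // pi_gt0.
- by rewrite gt_eqF.
Qed.

Lemma ccontM a b u v : ccont a b u -> ccont a b v -> ccont a b (fun x => u x * v x).
Proof. by move=> cu cv x xab; apply: ccont_atM; [exact: cu|exact: cv]. Qed.

Lemma ccontB a b u v : ccont a b u -> ccont a b v -> ccont a b (fun x => u x - v x).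
Proof. by move=> cu cv x xab; apply: ccont_atB; [exact: cu|exact: cv]. Qed.

Lemma ccontZ a b c u : ccont a b u -> ccont a b (fun x => c * u x).
Proof. by move=> cu; apply: ccontM => // x _; exact: ccont_at_cst. Qed.

Lemma ccont_fexp a b k : ccont a b (fexp k).
Proof. by move=> x _; exact: ccont_at_fexp. Qed.

Hint Resolve ccont_fexp : core.

Lemma ci_fexp k y : 0 <= y -> k != 0 ->
  ci 0 y (fexp k) = (0 +i* - (omega T k%:~R)^-1)%C * (fexp k y - 1).
Proof.
move=> y0 k0; rewrite mulrBr mulr1.
have -> : (0 +i* - (omega T k%:~R)^-1)%C = (0 +i* - (omega T k%:~R)^-1)%C * fexp k 0 :> R[i].
  by rewrite fexp_at0 mulr1.
rewrite fexp_at0 mulr1 -[X in _ - X]mulr1 -(fexp_at0 k).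
apply: (@ci_FTC2 _ _ _ _ (fun x => (0 +i* - (omega T k%:~R)^-1)%C * fexp k x)) => //.
move=> x _; have w0 := omega_neq0 k0.
have := cder_atM (cder_at_cst (0 +i* - (omega T k%:~R)^-1)%C x) (cder_at_fexp k x).
rewrite mul0r addr0 mulrA (_ : _ * (0 +i* omega T k%:~R)%C = 1) ?mul1r //.
apply: complex_ext; rewrite ?ReM ?ImM /= ?mulr0 ?mul0r ?subr0 ?addr0 //.
by rewrite mulNr opprK mulVf // add0r.
Qed.

Lemma ci_fexp0 y : 0 <= y -> ci 0 y (fexp 0) = (y%:C)%C.
Proof.
move=> y0; rewrite (eq_ci (v := fun=> 1)) => [|x _]; last exact: fexp0.
by rewrite ci_cst // subr0 mulr1.
Qed.

Lemma ci_fexp_period k : ci 0 T (fexp k) = if k == 0 then (T%:C)%C else 0.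
Proof.
case: eqP => [->|/eqP k0]; first by rewrite ci_fexp0 // ltW.
by rewrite ci_fexp ?ltW // fexp_atT subrr mulr0.
Qed.

Definition fcoef u k : R[i] := (T^-1%:C)%C * ci 0 T (fun x => u x * fexp (- k) x).

Lemma mul_TV : (T%:C)%C * (T^-1%:C)%C = 1 :> R[i].
Proof. by rewrite -rmorphM divff ?gt_eqF. Qed.

Lemma fcoef_ciE u k : ci 0 T (fun x => u x * fexp (- k) x) = (T%:C)%C * fcoef u k.
Proof. by rewrite /fcoef mulrA mul_TV mul1r. Qed.

(** Orthogonality, in the form that lets Bessel's inequality be proved by removing modes one at a
    time. *)
Lemma fcoef_subZ u c k l : ccont 0 T u ->
  fcoef (fun x => u x - c * fexp k x) l = fcoef u l - (if l == k then c else 0).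
Proof.
move=> cu; rewrite /fcoef (eq_ci (v := fun x => u x * fexp (- l) x - c * fexp (k - l) x)).
  rewrite ciB ?ciZ ?ci_fexp_period //; last 2 first.
  - exact: ccontM.
  - exact: ccontZ.
  rewrite mulrBr subr_eq0 eq_sym; congr (_ - _); case: eqP => _; last by rewrite !mulr0.
  by rewrite mulrCA mulrC [_ * (T%:C)%C]mulrC mul_TV mul1r.
by move=> x _; rewrite fexpD; ring.
Qed.

Definition energy u : R := T^-1 * \int[mu]_(x in `[0, T]) (nc (u x) ^+ 2).

Lemma energy_ge0 u : 0 <= energy u.
Proof.
rewrite /energy mulr_ge0 ?invr_ge0 ?(ltW T0) //.
by apply: Rintegral_ge0 => x _; rewrite sqr_ge0.
Qed.

Lemma ccont_at_sqr u x : ccont_at u x -> {for x, continuous (fun t => nc (u t) ^+ 2)}.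
Proof.
move=> [u1 u2]; rewrite (_ : (fun t => _) =
  (fun t => complex.Re (u t) * complex.Re (u t) + complex.Im (u t) * complex.Im (u t))).
  by apply: cvgD; apply: cvgM.
by apply/funext => t; rewrite nc_sqr !expr2.
Qed.

(** Multiplication by the unimodular e_(- k) turns the k-th component of u into the mean c of [G];
    what remains is the variance identity: the mean of |G - c|^2 is that of |G|^2 minus |c|^2. *)
Lemma energy_sub u k : ccont 0 T u ->
  energy (fun x => u x - fcoef u k * fexp k x) = energy u - nc (fcoef u k) ^+ 2.
Proof.
move=> cu; set c := fcoef u k.
pose G x := u x * fexp (- k) x.
have cG : ccont 0 T G by exact: ccontM.
have E x : nc (u x - c * fexp k x) ^+ 2 = nc (u x) ^+ 2 -
   (2 * complex.Re c * complex.Re (G x) + 2 * complex.Im c * complex.Im (G x)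
    - nc c ^+ 2).
  have -> : nc (u x) = nc (G x) by rewrite ncM nc_fexp mulr1.
  have -> : nc (u x - c * fexp k x) = nc (G x - c).
    rewrite -[LHS]mulr1 -(nc_fexp (- k) x) -ncM /G; congr nc.
    by rewrite mulrBl -mulrA [fexp k x * _]mulrC fexpN_mul mulr1.
  by rewrite !nc_sqr ReD ImD ReN ImN; ring.
rewrite /energy; under eq_Rintegral do rewrite E.
have iG1 := ccont_Re cG; have iG2 := ccont_Im cG.
have i1 : mu.-integrable `[0, T] (EFin \o (fun x => nc (u x) ^+ 2)).
  by apply: continuous_itv_integrable => x /cu/ccont_at_sqr.
have i2 : mu.-integrable `[0, T] (EFin \o (fun=> nc c ^+ 2)).
  by apply: continuous_itv_integrable => x _; exact: cvg_cst.
have i3 := integrableZl_itv (2 * complex.Re c) iG1.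
have i4 := integrableZl_itv (2 * complex.Im c) iG2.
have i5 := integrableD_itv i3 i4.
have i6 := integrableB_itv i5 i2.
rewrite RintegralB // RintegralB // RintegralD // Rintegral_cst_itv ?(ltW T0) //.
rewrite !RintegralZl_itv //.
have := fcoef_ciE u k; rewrite -/c -/G => ciG.
have -> : \int[mu]_(x in `[0, T]) complex.Re (G x) = T * complex.Re c.
  by rewrite -[LHS]/(complex.Re (ci 0 T G)) ciG Re_realM.
have -> : \int[mu]_(x in `[0, T]) complex.Im (G x) = T * complex.Im c.
  by rewrite -[LHS]/(complex.Im (ci 0 T G)) ciG Im_realM.
by rewrite nc_sqr; field; rewrite gt_eqF.
Qed.

Lemma bessel_inequality u (s : seq int) : uniq s -> ccont 0 T u ->
  \sum_(k <- s) nc (fcoef u k) ^+ 2 <= energy u.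
Proof.
elim: s u => [|k s IH] u; first by rewrite big_nil energy_ge0.
move=> /= /andP[ks us] cu; rewrite big_cons -lerBrDl -energy_sub //.
apply: le_trans (IH _ us _); last by apply: ccontB => //; exact: ccontZ.
rewrite le_eqVlt; apply/orP; left; apply/eqP; rewrite big_seq [RHS]big_seq.
apply: eq_bigr => l ls; rewrite fcoef_subZ //.
by case: eqP ls ks => [->|_ _ _]; rewrite ?subr0 // => ->.
Qed.

(** Squared coefficients are summable by Bessel's inequality. [Negz n] is - n - 1: the pairs
    enumerate the integers once, and are those left by the telescoping sum in [fsum_cvg]. *)
Lemma riemann_lebesgue u (e : R) : ccont 0 T u -> 0 < e ->
  exists N, forall n, (N <= n)%N ->
    nc (fcoef u n) < e /\ nc (fcoef u (Negz n)) < e.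
Proof.
move=> cu e0.
pose a n := nc (fcoef u (Posz n)) ^+ 2 + nc (fcoef u (Negz n)) ^+ 2.
have a0 n : 0 <= a n by rewrite addr_ge0 ?sqr_ge0.
have ca : cvgn (series a).
  apply: nondecreasing_is_cvgn.
    by apply: nondecreasing_series => n _ _; exact: a0.
  exists (energy u) => _ [n _ <-]; rewrite /series /=.
  rewrite (_ : \sum_(0 <= i < n) a i =
    \sum_(k <- map Posz (iota 0 n) ++ map Negz (iota 0 n)) nc (fcoef u k) ^+ 2).
    apply: bessel_inequality => //; rewrite cat_uniq !map_inj_uniq ?iota_uniq /=.
    - rewrite andbT; apply/hasPn => _ /mapP[i _ ->]; apply/negP => /mapP[j _ //].
    - by move=> i j [].
    - by move=> i j [].
  by rewrite big_cat /= !big_map -!/(index_iota 0 n) -big_split /= /index_iota subn0.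
have /cvgrPdist_lt/(_ (e ^+ 2)) := cvg_series_cvg_0 ca.
move=> /(_ (exprn_gt0 _ e0))[N _ NP]; exists N => n Nn.
have H : a n < e ^+ 2 by have := NP n Nn; rewrite sub0r normrN /= ger0_norm.
have sq z : nc z ^+ 2 < e ^+ 2 -> nc z < e.
  by rewrite ltr_pXn2r // nnegrE ?nc_ge0 // ltW.
split; apply: sq; apply: le_lt_trans H.
  by rewrite lerDl sqr_ge0.
by rewrite lerDr sqr_ge0.
Qed.

End FourierSeries.

(** * Pointwise convergence of Fourier series and geometric tails *)

Section PointwiseConvergence.
Context {R : realType}.
Variable T : R.
Hypothesis T0 : 0 < T.
Local Notation nc := (@Normc.normc R).
Implicit Types (u h g : R -> R[i]) (k l : int) (n m : nat).

Lemma slope_continuous (f g : R -> R) x0 x :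
  (forall z, f z - f x0 = g z * (z - x0)) -> x != x0 ->
  {for x, continuous f} -> {for x, continuous g}.
Proof.
move=> fg xx0 cf.
have -> : g = fun z => if z == x0 then g x0 else (f z - f x0) * (z - x0)^-1.
  apply/funext => z; case: eqP => [-> //|/eqP zx0].
  by rewrite fg mulfK // subr_eq0.
have cq : {for x, continuous (fun z => (f z - f x0) * (z - x0)^-1)}.
  apply: cvgM; first by apply: cvgB => //; exact: cvg_cst.
  apply: cvgV; first by rewrite subr_eq0.
  by apply: cvgB; [exact: cvg_id | exact: cvg_cst].
move: cq; rewrite /prop_for /continuous_at /= (negbTE xx0) => cq.
apply: cvg_trans cq; apply: near_eq_cvg.
have : \forall z \near x, z != x0.
  by apply: (@open_nbhs_nbhs _ _ [set z | z != x0]); split => //; exact: open_neq.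
by apply: filterS => z /negbTE ->.
Qed.

(** Caratheodory's form of differentiability: g is the difference quotient, continued by d at x0,
    and inherits the continuity of u. *)
Lemma slope u x0 d : cder_at u x0 d ->
  exists g, [/\ forall x, u x - u x0 = g x * ((x - x0)%:C)%C,
    forall x, ccont_at u x -> ccont_at g x & g x0 = d].
Proof.
move=> [/is_derive1_caratheodory[g1 [E1 c1 d1]]].
move=> /is_derive1_caratheodory[g2 [E2 c2 d2]].
exists (fun x => (g1 x +i* g2 x)%C); split.
- move=> x; apply: complex_ext; rewrite ?ReD ?ImD ?ReN ?ImN ?ReM ?ImM /=.
    by rewrite E1 mulr0 subr0.
  by rewrite E2 mulr0 add0r.
- move=> x [u1 u2]; have [->|xx0] := eqVneq x x0; first by split.
  by split; [exact: slope_continuous E1 xx0 u1 | exact: slope_continuous E2 xx0 u2].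
- by rewrite d1 d2; case: d {d1 d2}.
Qed.

Lemma ccont_atV u x : ccont_at u x -> u x != 0 -> ccont_at (fun t => (u t)^-1) x.
Proof.
move=> cu ux0; have [u1 u2] := cu.
pose n2 t := complex.Re (u t) ^+ 2 + complex.Im (u t) ^+ 2.
have cn : {for x, continuous n2}.
  rewrite (_ : n2 = fun t => nc (u t) ^+ 2); first exact: ccont_at_sqr.
  by apply/funext => t; rewrite nc_sqr.
have n0 : n2 x != 0.
  rewrite /n2 -nc_sqr expf_eq0 /=; apply: contra_neq ux0.
  exact: Normc.eq0_normc.
split.
  rewrite (_ : (fun t => _) = fun t => complex.Re (u t) * (n2 t)^-1).
    by apply: cvgM => //; exact: cvgV.
  by apply/funext => t; rewrite /n2; case: (u t).
rewrite (_ : (fun t => _) = fun t => - (complex.Im (u t) * (n2 t)^-1)).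
  by apply: cvgN; apply: cvgM => //; exact: cvgV.
by apply/funext => t; rewrite /n2; case: (u t).
Qed.

(** Half-angle formula: 1 - cos t = 2 sin (t / 2) ^ 2, and the sine does not vanish strictly between
    0 and pi. *)
Lemma expi_eq1 (t : R) : `|t| < 2 * pi -> expi t = 1 -> t = 0.
Proof.
move=> t2 [] ct _; apply/eqP/negPn/negP => t0.
pose s := `|t| / 2.
have sin0 : 0 < sin s.
  apply: sin_gt0_pi; rewrite /s divr_gt0 ?normr_gt0 //=.
  by rewrite ltr_pdivrMr // mulrC.
have : cos (s *+ 2) = 1.
  rewrite -mulr_natr /s divfK //; case: (lerP 0 t) => [?|?].
    by rewrite ger0_norm.
  by rewrite ltr0_norm // cosN.
rewrite cos_mulr2n cos2sin2 => H.
have : sin s ^+ 2 = 0 by move: H; rewrite mulr2n; lra.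
by move/eqP; rewrite expf_eq0 /= gt_eqF.
Qed.

(** Numerator and denominator are both divided by x - x0. The slope p of the denominator has no
    zero: it is i omega_1 at x0, and e_1(x - x0) = 1 with |x - x0| < T forces x = x0. If x0 were an
    end of the period, the other end would be a second zero, hence the open interval. *)
Lemma slope_quotient u x0 d : 0 < x0 < T -> ccont 0 T u -> cder_at u x0 d ->
  exists2 h, ccont 0 T h & forall x, 0 <= x <= T ->
    u x - u x0 = h x * (fexp T 1 (x - x0) - 1).
Proof.
move=> /andP[x00 x0T] cu /slope[g [gE gc gd]].
have : cder_at (fun x => fexp T 1 (x - x0)) x0 (0 +i* omega T 1)%C.
  rewrite (_ : (fun x => _) = (fun x => fexp T 1 x * fexp T (- 1) x0)); last first.
    by apply/funext => x; rewrite fexpB.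
  have := cder_atM (cder_at_fexp T 1 x0) (cder_at_cst (fexp T (- 1) x0) x0).
  rewrite mulr0 add0r -mulrA [fexp T 1 x0 * _]mulrC fexpN_mul // mulr1.
  exact.
move=> /slope[p [pE pc pd]].
have pn x : 0 <= x <= T -> p x != 0.
  move=> /andP[xl xT]; have [->|xx0] := eqVneq x x0.
    have := omega_neq0 T0 (oner_neq0 _); rewrite pd eq_complex /= => /negbTE ->.
    by rewrite andbF.
  apply/eqP => px0; have := pE x; rewrite px0 mul0r subrr fexp_at0 => /eqP.
  rewrite subr_eq0 /fexp => /eqP/expi_eq1 H.
  have : omega T 1 * (x - x0) = 0.
    apply: H; rewrite /omega mulr1 mulrAC normrM normfV (gtr0_norm T0).
    rewrite ltr_pdivrMr // normrM gtr0_norm ?mulr_gt0 ?pi_gt0 //.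
    rewrite ltr_pM2l ?mulr_gt0 ?pi_gt0 // ltr_norml; apply/andP; split; lra.
  move/eqP; rewrite mulf_eq0 (negbTE (omega_neq0 T0 (oner_neq0 _))) /=.
  by rewrite subr_eq0 (negbTE xx0).
exists (fun x => g x * (p x)^-1).
  move=> x xT; apply: ccont_atM; first by apply: gc; exact: cu.
  apply: ccont_atV (pn x xT); apply: pc.
  rewrite (_ : (fun x => _) = (fun x => fexp T 1 x * fexp T (- 1) x0)); last first.
    by apply/funext => z; rewrite fexpB.
  by apply: ccont_atM; [exact: ccont_at_fexp | exact: ccont_at_cst].
move=> x xT; rewrite gE; have := pE x; rewrite subrr fexp_at0 => ->.
by rewrite -mulrA mulKf // pn.
Qed.

Definition fsum u n (x : R) : R[i] := fcoef T u 0 +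
  \sum_(j < n) (fcoef T u j.+1 * fexp T j.+1 x + fcoef T u (Negz j) * fexp T (Negz j) x).

(* With u - u(x0) = h (e_1(. - x0) - 1), the k-th term of the Fourier series of
   u - u(x0) at x0 is G(k - 1) - G(k), where G(k) = e_k(x0) (fcoef h k). *)
Lemma fsum_cvg u x0 d : 0 < x0 < T -> ccont 0 T u -> cder_at u x0 d ->
  forall e : R, 0 < e -> exists N, forall n, (N <= n)%N -> nc (fsum u n x0 - u x0) < e.
Proof.
move=> x0T cu du e e0.
have [h ch hE] := slope_quotient x0T cu du.
pose G k := fexp T k x0 * fcoef T h k.
have tele k : fcoef T u k * fexp T k x0 = G (k - 1) - G k + (if k == 0 then u x0 else 0).
  have E : ci 0 T (fun x => u x * fexp T (- k) x) =
      u x0 * (if k == 0 then (T%:C)%C else 0) +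
      fexp T (- 1) x0 * ((T%:C)%C * fcoef T h (k - 1)) - (T%:C)%C * fcoef T h k.
    rewrite -(fcoef_ciE T0 h) -(fcoef_ciE T0 h).
    have := ci_fexp_period T0 (- k); rewrite oppr_eq0 => <-.
    have cf l : ccont 0 T (fexp T l) by exact: ccont_fexp.
    rewrite -ciZ // -ciZ; last exact: ccontM.
    rewrite -ciD; first last.
    - by apply: ccontZ; exact: ccontM.
    - exact: ccontZ.
    rewrite -ciB; first last.
    - exact: ccontM.
    - move=> x xT; apply: ccont_atD; first exact: (ccontZ (u x0) (cf _)).
      by apply: (ccontZ (fexp T (- 1) x0) (ccontM ch (cf _))).
    apply: eq_ci => x xT.
    have -> : u x = u x0 + h x * (fexp T 1 x * fexp T (- 1) x0 - 1).
      by rewrite -fexpB // -hE // addrC subrK.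
    have -> : fexp T (- (k - 1)) x = fexp T (- k) x * fexp T 1 x.
      by rewrite -fexpD // opprB addrC.
    ring.
  rewrite {1}/fcoef E /G (_ : fexp T (k - 1) x0 = fexp T k x0 * fexp T (- 1) x0); last first.
    by rewrite -fexpD.
  have TV := mul_TV T0.
  case: eqP => [->|_].
    rewrite fexp0; transitivity ((T%:C)%C * (T^-1%:C)%C *
      (fexp T (-1) x0 * fcoef T h (0 - 1) - fcoef T h 0 + u x0)); first by ring.
    by rewrite TV; ring.
  rewrite mulr0 add0r addr0; transitivity ((T%:C)%C * (T^-1%:C)%C *
    (fexp T (-1) x0 * fcoef T h (k - 1) - fcoef T h k) * fexp T k x0); first by ring.
  by rewrite TV; ring.
have sumE n : fsum u n x0 - u x0 = G (Negz n) - G n.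
  elim: n => [|n IH].
    rewrite /fsum big_ord0 addr0 -[fcoef T u 0]mulr1 -(fexp0 T x0) tele /=.
    by rewrite addrK.
  have -> : fsum u n.+1 x0 = fsum u n x0 + (fcoef T u n.+1 * fexp T n.+1 x0 +
      fcoef T u (Negz n) * fexp T (Negz n) x0).
    by rewrite /fsum big_ord_recr /= addrA.
  rewrite addrAC IH !tele /= (_ : Posz n.+1 - 1 = Posz n); last by rewrite -addn1 PoszD addrK.
  rewrite (_ : Negz n - 1 = Negz n.+1); last by rewrite !NegzE -opprD -PoszD addn1.
  ring.
have [N NP] := riemann_lebesgue T0 ch (divr_gt0 e0 (ltr0n _ 2)).
exists N => n Nn; rewrite sumE /G; have [H1 H2] := NP n Nn.
apply: le_lt_trans (ncD _ _) _; rewrite ncN !(ncM (fexp _ _ _)) !nc_fexp !mul1r; lra.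
Qed.

(** Pointwise convergence is obtained at interior points only; continuity carries the resulting
    bound to 0 and T. Squares are compared because the squared modulus is polynomial in the real and
    imaginary parts. *)
Lemma closed_bound v M : ccont 0 T v -> (forall x, 0 < x < T -> nc (v x) <= M) ->
  forall x, 0 <= x <= T -> nc (v x) <= M.
Proof.
move=> cv vM.
have mid : 0 < T / 2 < T by rewrite divr_gt0 //= ltr_pdivrMr // ltr_pMr // ltr1n.
have M0 : 0 <= M := le_trans (nc_ge0 _) (vM _ mid).
have sq x : nc (v x) ^+ 2 <= M ^+ 2 -> nc (v x) <= M.
  by rewrite ler_pXn2r // nnegrE nc_ge0.
have sq' x : 0 < x < T -> nc (v x) ^+ 2 <= M ^+ 2.
  by move=> /vM; rewrite ler_pXn2r // nnegrE nc_ge0.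
move=> x /andP[]; rewrite le_eqVlt => /predU1P[<- _|x0].
  have c0 : {for 0, continuous (fun t => nc (v t) ^+ 2)}.
    by apply/ccont_at_sqr/cv; rewrite lexx ltW.
  apply: sq; apply: (ler_cvg_to (cvg_at_right_filter c0) (cvg_cst (M ^+ 2))).
  near=> y; apply: sq'; apply/andP; split; near: y.
    exact: nbhs_right_gt.
  exact: nbhs_right_lt.
rewrite le_eqVlt => /predU1P[->|xT]; last by apply: vM; rewrite x0.
have cT : {for T, continuous (fun t => nc (v t) ^+ 2)}.
  by apply/ccont_at_sqr/cv; rewrite lexx ltW.
apply: sq; apply: (ler_cvg_to (cvg_at_left_filter cT) (cvg_cst (M ^+ 2))).
near=> y; apply: sq'; apply/andP; split; near: y.
  exact: nbhs_left_gt.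
exact: nbhs_left_lt.
Unshelve. all: by end_near. Qed.

Lemma geometric_tail (q : R) n m : 0 <= q < 1 -> (n <= m)%N ->
  \sum_(n <= j < m) q ^+ j.+1 <= q ^+ n.+1 / (1 - q).
Proof.
move=> /andP[q0 q1] nm; rewrite ler_pdivlMr ?subr_gt0 //.
suff -> : (\sum_(n <= j < m) q ^+ j.+1) * (1 - q) = q ^+ n.+1 - q ^+ m.+1.
  by rewrite gerBl exprn_ge0.
move: nm => /subnK <-; elim: (m - n)%N => [|i IH].
  by rewrite add0n big_geq // mul0r subrr.
by rewrite addSn big_nat_recr ?leq_addl //= mulrDl IH [q ^+ (i + n).+2]exprS; ring.
Qed.

Lemma ccont_fsum a b u n : ccont a b (fsum u n).
Proof.
move=> x _; apply: ccont_atD; first exact: ccont_at_cst.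
by apply: ccont_at_sum => i; apply: ccont_atD; apply: ccont_atM;
  solve [exact: ccont_at_cst | exact: ccont_at_fexp].
Qed.

(** The sum between n and m is bounded through the decay of the coefficients, then m is sent to
    infinity at each x separately; the bound is uniform in x. The factor 2 counts k and - k. *)
Lemma fsum_tail u d (D q : R) : 0 <= D -> 0 <= q < 1 -> ccont 0 T u ->
  (forall x, 0 < x < T -> cder_at u x (d x)) ->
  (forall k, k != 0 -> nc (fcoef T u k) <= D * q ^+ `|k|%N) ->
  forall n x, 0 <= x <= T -> nc (u x - fsum u n x) <= 2 * D * (q ^+ n.+1 / (1 - q)).
Proof.
move=> D0 q01 cu du cD n; apply: closed_bound.
  by apply: ccontB => //; exact: ccont_fsum.
move=> x xT; apply/ler_addgt0Pr => e e0.
have [N NP] := fsum_cvg xT cu (du x xT) e0.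
pose m := maxn n N.
apply: le_trans (nc_triangle (fsum u m x) _ _) _; rewrite addrC; apply: lerD; last first.
  by rewrite ncB; apply/ltW/NP; exact: leq_maxr.
rewrite /fsum opprD addrACA subrr add0r.
rewrite -!(big_mkord xpredT (fun j => fcoef T u j.+1 * fexp T j.+1 x +
  fcoef T u (Negz j) * fexp T (Negz j) x)).
have nm : (n <= m)%N by exact: leq_maxl.
rewrite (@big_cat_nat _ _ _ n) //= addrAC subrr add0r.
apply: le_trans (nc_sum _ _ _) _.
apply: (@le_trans _ _ (2 * D * \sum_(n <= j < m) q ^+ j.+1)); last first.
  by rewrite ler_wpM2l ?mulr_ge0 // geometric_tail.
rewrite mulr_sumr; apply: ler_sum => j _.
apply: le_trans (ncD _ _) _; rewrite !(ncM (fcoef _ _ _)) !nc_fexp !mulr1.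
have H1 := cD (Posz j.+1) isT; have H2 := cD (Negz j) isT.
move: H1 H2; rewrite /=; lra.
Qed.

End PointwiseConvergence.

(** * The quadrature rule *)

Section Quadrature.
Context {R : realType}.
Variables (T : R) (N : nat).
Hypotheses (T0 : 0 < T) (N0 : (0 < N)%N).
Local Notation nc := (@Normc.normc R).
Local Notation x_ := (node T N).
Implicit Types (u v : R -> R[i]) (k : int) (l : 'I_N).

Lemma node_itv j : (j < N)%N -> 0 <= x_ j <= T.
Proof.
move=> jN; rewrite /node; apply/andP; split.
  by rewrite !mulr_ge0 ?invr_ge0 // ltW.
by rewrite ler_pdivrMr ?ltr0n // ler_wpM2l ?ler_nat ?ltW // ltnW.
Qed.

Lemma fexp_node k j : fexp T k (x_ j) = expi (2 * pi * k%:~R / N%:R) ^+ j.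
Proof.
rewrite /fexp /omega /node.
have -> : 2 * pi * k%:~R / T * (T * j%:R / N%:R) = (2 * pi * k%:~R / N%:R) * j%:R :> R.
  by field; rewrite ?pnatr_eq0 -?lt0n ?N0 ?gt_eqF.
elim: j => [|j IH]; first by rewrite mulr0 expi0 expr0.
by rewrite exprS -IH -expiD -[j.+1%:R]natr1; congr expi; ring.
Qed.

Lemma fexp_alias k a j : fexp T (k + N%:Z * a) (x_ j) = fexp T k (x_ j).
Proof.
rewrite fexpD // !fexp_node -exprMn -expiD -mulrDl; congr (_ ^+ j).
rewrite -[RHS]mulr1 -(expi_2pi_int a) -expiD; congr expi.
by rewrite intrM; field; rewrite pnatr_eq0 -lt0n.
Qed.

(** Geometric sum of an N-th root of unity z, which differs from 1 because 0 < |m - n| < N. *)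
Lemma node_orthogonality (m n : 'I_N) :
  \sum_(j < N) fexp T (m%:Z - n%:Z) (x_ j) = if m == n then N%:R else 0.
Proof.
case: eqP => [->|mn].
  under eq_bigr do rewrite subrr fexp0.
  by rewrite sumr_const card_ord.
under eq_bigr do rewrite fexp_node.
set z := expi _.
have zN : z ^+ N = 1.
  rewrite /z -fexp_node (_ : x_ N = T) ?fexp_atT //.
  by rewrite /node mulfK // pnatr_eq0 -lt0n.
have z1 : z - 1 != 0.
  rewrite subr_eq0; apply/eqP => /expi_eq1 H; apply: mn.
  have : 2 * pi * (m%:Z - n%:Z)%:~R / N%:R = 0 :> R.
    apply: H; rewrite normrM normfV normr_nat ltr_pdivrMr ?ltr0n //.
    rewrite normrM gtr0_norm ?mulr_gt0 ?pi_gt0 //.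
    rewrite ltr_pM2l ?mulr_gt0 ?pi_gt0 // -intr_norm -[N%:R]/(N%:Z%:~R) ltr_int.
    have := ltn_ord m; have := ltn_ord n; lia.
  move/eqP; rewrite !mulf_eq0 invr_eq0 !pnatr_eq0 (gt_eqF (pi_gt0 R)) /= intr_eq0.
  rewrite -[N == 0]negbK -lt0n N0 orbF subr_eq0 => /eqP[] mn.
  exact: val_inj.
by apply: (mulfI z1); rewrite mulr0 -subrX1 zN subrr.
Qed.

Definition mode (m : nat) : int := m%:Z - N./2%:Z.

Lemma half_lt : (N./2 < N)%N.
Proof. by move: N0; lia. Qed.

(** Each term of the bracket in the definition is the integral of a mode over [0, x_l]: x_l for k =
    0, (e_k(x_l) - 1) / (i omega_k) otherwise. Row l thus integrates the Fourier interpolant. *)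
Lemma fourier_integration_matrixE l (j : 'I_N) :
  fourier_integration_matrix T N l j =
  N%:R^-1 * \sum_(m < N) fexp T (- mode m) (x_ j) * ci 0 (x_ l) (fexp T (mode m)).
Proof.
rewrite mxE; congr (_ * _).
have xl0 : 0 <= x_ l by case/andP: (node_itv (ltn_ord l)).
rewrite [RHS](bigD1 (Ordinal half_lt)) //= /mode subrr oppr0 fexp0 mul1r ci_fexp0 //.
congr (_ + _); rewrite mulr_sumr; apply: eq_big => [m|m mN] //=.
have kE : (m%:R - (N./2)%:R : R) = (m%:Z - N./2%:Z)%:~R by rewrite intrB.
have k0 : m%:Z - N./2%:Z != 0 by rewrite subr_eq0; apply: contra_neq mN => -[].
rewrite kE ci_fexp //; set k := m%:Z - N./2%:Z.
have -> : expi (- (omega T k%:~R * x_ j)) = fexp T (- k) (x_ j).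
  by rewrite /fexp; congr expi; rewrite /omega intrN; ring.
rewrite -/(fexp T k (x_ l)).
(* Both sides are 1 / (i omega_k). *)
have -> : (0 +i* - (omega T k%:~R)^-1)%C =
    - ((T%:C)%C * 'i%C / ((2 * pi)%:C)%C * ((k%:~R)%:C)%C^-1) :> R[i].
  have p0 : 2 * pi != 0 :> R by rewrite gt_eqF // mulr_gt0 // pi_gt0.
  have kr0 : k%:~R != 0 :> R by rewrite intr_eq0.
  rewrite -!fmorphV -mulrA -rmorphM mulrAC -rmorphM.
  apply: complex_ext; rewrite ?ReN ?ImN ?Re_realM ?Im_realM /= ?mulr0 ?oppr0 //.
  by rewrite mulr1 /omega !invfM invrK; congr (- _); ring.
by ring.
Qed.

Lemma quadrature_mode l (m : 'I_N) :
  \sum_(j < N) fourier_integration_matrix T N l j * fexp T (mode m) (x_ j) =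
  ci 0 (x_ l) (fexp T (mode m)).
Proof.
under eq_bigr => j _ do rewrite fourier_integration_matrixE -mulrA mulr_suml.
rewrite -mulr_sumr exchange_big /=.
have NC : N%:R != 0 :> R[i] by rewrite pnatr_eq0 -lt0n.
rewrite (bigD1 m) //= [X in _ + X]big1 ?addr0 => [|n nm].
  have := node_orthogonality m m; rewrite eqxx => H.
  under eq_bigr => j _ do rewrite mulrAC fexpN_mul // -(fexp0 T (x_ j)) -(subrr m%:Z).
  by rewrite -mulr_suml H mulKf.
have E (j : 'I_N) : fexp T (- mode n) (x_ j) * ci 0 (x_ l) (fexp T (mode n)) *
    fexp T (mode m) (x_ j) = fexp T (m%:Z - n%:Z) (x_ j) * ci 0 (x_ l) (fexp T (mode n)).
  by rewrite mulrAC -fexpD //; congr (fexp T _ _ * _); rewrite /mode; ring.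
under eq_bigr do rewrite E.
by rewrite -mulr_suml node_orthogonality eq_sym (negbTE nm) mul0r.
Qed.

(** The error before the modulus is taken, hence linear in the integrand; the integrand is a
    function of a real variable, so that single modes and partial sums are allowed. *)
Definition qerr l u : R[i] :=
  ci 0 (x_ l) u - \sum_(j < N) fourier_integration_matrix T N l j * u (x_ j).

Lemma ccont_node l u : ccont 0 T u -> ccont 0 (x_ l) u.
Proof.
move=> cu x /andP[x0 xl]; apply: cu; rewrite x0 (le_trans xl) //.
by case/andP: (node_itv (ltn_ord l)).
Qed.

Lemma qerrD l u v : ccont 0 T u -> ccont 0 T v ->
  qerr l (fun x => u x + v x) = qerr l u + qerr l v.
Proof.
move=> /(@ccont_node l) cu /(@ccont_node l) cv; rewrite /qerr ciD //.
under eq_bigr do rewrite mulrDr.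
by rewrite big_split /=; ring.
Qed.

Lemma qerrZ l c u : ccont 0 T u -> qerr l (fun x => c * u x) = c * qerr l u.
Proof.
move=> /(@ccont_node l) cu; rewrite /qerr ciZ // mulrBr mulr_sumr.
by congr (_ - _); apply: eq_bigr => j _; ring.
Qed.

Lemma qerr_mode l (m : 'I_N) : qerr l (fexp T (mode m)) = 0.
Proof. by rewrite /qerr quadrature_mode subrr. Qed.

(** The quadrature of e_k is itself the integral of a mode, so two integrals of modulus at most 2 T
    are compared; the row sums of the matrix do not enter, and the bound is independent of k, l and
    N. *)
Lemma qerr_fexp l k : nc (qerr l (fexp T k)) <= 4 * T.
Proof.
(* The shift by N/2 before reduction modulo N yields an index in the numbering of [mode]. *)
pose p := (k + N./2%:Z)%R.
have NZ : N%:Z != 0 by rewrite eqz_nat -lt0n.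
have m0 := modz_ge0 p NZ.
have mN : (`|(p %% N)%Z| < N)%N.
  by have := ltz_mod p NZ; have := m0; lia.
pose m := Ordinal mN.
have kE : k = mode m + N%:Z * (p %/ N)%Z.
  have := divz_eq p N; rewrite /mode /= gez0_abs // /p; lia.
have -> : qerr l (fexp T k) = ci 0 (x_ l) (fexp T k) - ci 0 (x_ l) (fexp T (mode m)).
  rewrite /qerr -quadrature_mode; congr (_ - _); apply: eq_bigr => j _.
  by rewrite {1}kE fexp_alias.
have /andP[xl0 xlT] := node_itv (ltn_ord l).
have B k' : nc (ci 0 (x_ l) (fexp T k')) <= 2 * T.
  apply: le_trans (@ci_bound _ _ _ _ 1 xl0 _ _) _.
  - by move=> x _; exact: ccont_at_fexp.
  - by move=> x _; rewrite nc_fexp.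
  - by rewrite mul1r subr0 ler_pM2l.
apply: le_trans (ncD _ _) _; rewrite ncN.
apply: le_trans (lerD (B k) (B (mode m))) _.
by rewrite -mulrDl -natrD.
Qed.

(** The row sum depends on N; the bound is only applied to Fourier remainders that tend to 0 with N
    fixed. *)
Lemma qerr_bound l v tau : ccont 0 T v -> (forall x, 0 <= x <= T -> nc (v x) <= tau) ->
  nc (qerr l v) <= (2 * T + \sum_(j < N) nc (fourier_integration_matrix T N l j)) * tau.
Proof.
move=> cv vt; have /andP[xl0 xlT] := node_itv (ltn_ord l).
have tau0 : 0 <= tau by apply: le_trans (nc_ge0 _) (vt 0 _); rewrite lexx ltW.
apply: le_trans (ncD _ _) _; rewrite ncN mulrDl lerD //.
  apply: le_trans (ci_bound xl0 (@ccont_node l _ cv) _) _.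
    by move=> x /andP[x0 xl]; apply: vt; rewrite x0 (le_trans xl).
  by rewrite subr0 -mulrA ler_pM2l // mulrC ler_wpM2r.
apply: le_trans (nc_sum _ _ _) _; rewrite mulr_suml; apply: ler_sum => j _.
by rewrite ncM ler_wpM2l ?nc_ge0 // vt // node_itv.
Qed.

(** [t] groups k and - k, each charged 4 T by [qerr_fexp], whence 8 T. The estimate is uniform in
    the length n of the partial sum. *)
Lemma qerr_fsum l u n (D q : R) : 0 <= D -> 0 <= q < 1 -> (0 < N./2)%N ->
  (forall k, k != 0 -> nc (fcoef T u k) <= D * q ^+ `|k|%N) ->
  nc (qerr l (fsum T u n)) <= 8 * T * D * (q ^+ N./2 / (1 - q)).
Proof.
move=> D0 q01 H0 cD; have /andP[q0 q1] := q01.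
have cf a k : ccont 0 T (fun x => a * fexp T k x).
  by apply: ccontZ; exact: ccont_fexp.
pose t j := fcoef T u (Posz j.+1) * qerr l (fexp T j.+1) +
  fcoef T u (Negz j) * qerr l (fexp T (Negz j)).
have E : qerr l (fsum T u n) = \sum_(0 <= j < n) t j.
  elim: n => [|n IH].
    (* The constant term is a multiple of the mode of index N/2, which is exact. *)
    rewrite big_geq //; transitivity
      (qerr l (fun x => fcoef T u 0 * fexp T (mode (Ordinal half_lt)) x)).
      congr qerr; apply/funext => x.
      by rewrite /fsum big_ord0 addr0 /mode /= subrr fexp0 mulr1.
    by rewrite qerrZ ?qerr_mode ?mulr0 //; exact: ccont_fexp.
  rewrite big_nat_recr //= -IH /t -!qerrZ //; try exact: ccont_fexp.
  rewrite -qerrD // -qerrD; first last.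
  - by move=> x xT; apply: ccont_atD; exact: (cf _ _ x xT).
  - exact: ccont_fsum.
  by congr qerr; apply/funext => x; rewrite /fsum big_ord_recr /= addrA.
(* A pair contributes nothing when both j + 1 and - (j + 1) are frequencies of the interpolant. For
   N even and j + 1 = N/2 only - N/2 is one, so the tail starts at q ^ (N/2). *)
have tz j : (j.+1 < N./2)%N -> t j = 0.
  move=> jN; rewrite /t.
  have h1 : (j.+1 + N./2 < N)%N by move: jN; lia.
  have h2 : (N./2 - j.+1 < N)%N by move: N0; lia.
  have -> : Posz j.+1 = mode (Ordinal h1) by rewrite /mode /=; lia.
  have -> : Negz j = mode (Ordinal h2) by rewrite /mode /=; lia.
  by rewrite !qerr_mode !mulr0 addr0.
have tb j : nc (t j) <= 8 * T * D * q ^+ j.+1.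
  apply: le_trans (ncD _ _) _; rewrite !(ncM (fcoef _ _ _)).
  have H1 := cD (Posz j.+1) isT; have H2 := cD (Negz j) isT.
  have Q0 : 0 <= D * q ^+ j.+1 by rewrite mulr_ge0 ?exprn_ge0.
  apply: le_trans (lerD (ler_pM (nc_ge0 _) (nc_ge0 _) H1 (qerr_fexp l _))
    (ler_pM (nc_ge0 _) (nc_ge0 _) H2 (qerr_fexp l _))) _.
  by rewrite /= le_eqVlt; apply/orP; left; apply/eqP; ring.
have Q1 : 0 <= 8 * T * D * (q ^+ N./2 / (1 - q)).
  by rewrite !mulr_ge0 ?exprn_ge0 ?invr_ge0 ?subr_ge0 ?(ltW T0) ?(ltW q1).
rewrite E; have [nN|Nn] := leqP n (N./2).-1.
  rewrite big_nat big1 ?Normc.normc0 // => j jn; apply: tz.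
  by move: jn nN; lia.
rewrite (@big_cat_nat _ _ _ (N./2).-1) //=; last exact: ltnW.
rewrite [X in X + _]big_nat [X in X + _]big1 ?add0r => [|j jn]; last first.
  by apply: tz; move: jn; lia.
apply: le_trans (nc_sum _ _ _) _.
apply: (@le_trans _ _ (8 * T * D * \sum_((N./2).-1 <= j < n) q ^+ j.+1)).
  by rewrite mulr_sumr; apply: ler_sum.
rewrite ler_wpM2l ?mulr_ge0 ?(ltW T0) //.
by apply: le_trans (geometric_tail q01 (ltnW Nn)) _; rewrite prednK.
Qed.

(** u is a partial sum plus a remainder. As n grows with N fixed, the remainder is killed by q ^ n
    in spite of the factor [W], and the bound on partial sums, independent of n, survives. *)
Lemma qerr_le l u d (D q : R) : 0 <= D -> 0 <= q < 1 -> (0 < N./2)%N ->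
  ccont 0 T u -> (forall x, 0 < x < T -> cder_at u x (d x)) ->
  (forall k, k != 0 -> nc (fcoef T u k) <= D * q ^+ `|k|%N) ->
  nc (qerr l u) <= 8 * T * D * (q ^+ N./2 / (1 - q)).
Proof.
move=> D0 q01 H0 cu du cD.
pose W := 2 * T + \sum_(j < N) nc (fourier_integration_matrix T N l j).
pose c := W * (2 * D * (q / (1 - q))).
have H n : nc (qerr l u) <= 8 * T * D * (q ^+ N./2 / (1 - q)) + c * q ^+ n.
  have E : qerr l u = qerr l (fsum T u n) + qerr l (fun x => u x - fsum T u n x).
    rewrite -qerrD; first last.
    - by apply: ccontB => //; exact: ccont_fsum.
    - exact: ccont_fsum.
    by congr qerr; apply/funext => x; rewrite addrC subrK.
  rewrite E; apply: le_trans (ncD _ _) _; apply: lerD; first exact: qerr_fsum.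
  apply: le_trans (qerr_bound l _ (fsum_tail T0 D0 q01 cu du cD n)) _.
    by apply: ccontB => //; exact: ccont_fsum.
  by rewrite -/W /c exprS le_eqVlt; apply/orP; left; apply/eqP; ring.
have q1 : `|q| < 1 by case/andP: q01 => q0 q1; rewrite ger0_norm.
have cv : (fun n => 8 * T * D * (q ^+ N./2 / (1 - q)) + c * q ^+ n) @ \oo -->
    8 * T * D * (q ^+ N./2 / (1 - q)).
  rewrite -[X in _ --> X]addr0; apply: cvgD; first exact: cvg_cst.
  exact: cvg_geometric.
by apply: (ler_cvg_to (cvg_cst _) cv); apply: nearW.
Qed.

End Quadrature.

(** * Analytic functions near the rectangle *)

Section ContourShift.
Context {R : realType}.
Variable T : R.
Hypothesis T0 : 0 < T.
Local Notation nc := (@Normc.normc R).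
Implicit Types (f : R[i] -> R[i]) (x y s b : R) (k : int).

(** Local constants merge into one because P is monotone in K: the near-covering form of compactness
    is applied with the constant running to +oo. *)
Lemma itv_compactness (P : R -> R -> Prop) a b :
  (forall K L x, 0 < K -> K <= L -> P K x -> P L x) ->
  (forall x, a <= x <= b -> exists2 K, 0 < K &
     exists2 d, 0 < d & forall x', `|x' - x| < d -> P K x') ->
  exists2 K, 0 < K & forall x, a <= x <= b -> P K x.
Proof.
move=> Pmono Ploc.
have /compact_near_coveringP cab := @segment_compact R a b.
have := cab R (pinfty_nbhs R) (fun K x => 0 < K /\ P K x) _.
case=> [x|].
  rewrite /= in_itv /= => /Ploc[K K0 [d d0 PK]].
  exists (ball x d, [set L | K < L]) => /=.
    by split; [exact: nbhsx_ballx | exists K; split => //; exact: num_real].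
  move=> [x' L] /= [xx' KL]; split; first exact: lt_trans KL.
  apply: Pmono (ltW KL) _ => //; apply: PK.
  by rewrite distrC.
move=> M [_ MP]; exists (Num.max M 0 + 1).
  by rewrite ltr_wpDl // le_max lexx orbT.
move=> x xab; have /MP : M < Num.max M 0 + 1 by rewrite ltr_pwDr // le_max lexx.
by move=> /(_ x); case; rewrite ?in_itv.
Qed.

(** Analyticity as one quantitative expansion per point: the form that differentiation preserves and
    that compactness consumes. *)
Definition expansible (A : set R[i]) f :=
  forall z, A z -> exists a rho B, expands f z a rho B.

Lemma expansible_cder (A : set R[i]) f : expansible A f -> expansible A (cder f).
Proof.
move=> fA z /fA[a [rho [B fE]]].
by exists (dcoef a), (rho / 2), (B / rho); exact: expands_cder.
Qed.

Lemma isder_horizontal f x y d : isder f (x +i* y)%C d ->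
  cder_at (fun t => f (t +i* y)%C) x d.
Proof.
move=> [K K0 KP].
have H h : `|h| <= K^-1 ->
    nc (f ((x + h) +i* y)%C - f (x +i* y)%C - d * (h%:C)%C) <= K * h ^+ 2.
  move=> hK; rewrite (_ : ((x + h) +i* y)%C = (x +i* y)%C + (h%:C)%C); last first.
    by apply: complex_ext; rewrite ?ReD ?ImD /= ?addr0.
  by apply: le_trans (KP _ _) _; rewrite nc_real // real_normK ?num_real.
split; apply: (is_derive_quadratic K0) => h /H.
  apply: le_trans; apply: le_trans (Re_le_nc _).
  by rewrite !ReD !ReN [d * _]mulrC Re_realM [h * _]mulrC.
apply: le_trans; apply: le_trans (Im_le_nc _).
by rewrite !ImD !ImN [d * _]mulrC Im_realM [h * _]mulrC.
Qed.

Lemma expansible_cder_at b f x y : expansible (rectangle T b) f ->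
  0 <= x <= T -> - b <= y <= b ->
  cder_at (fun t => f (t +i* y)%C) x (cder f (x +i* y)%C).
Proof.
move=> fA xT yb; apply: isder_horizontal.
by have [|a [rho [B /expands_isder]]] := fA (x +i* y)%C.
Qed.

Lemma expansible_ccont b f y : expansible (rectangle T b) f ->
  - b <= y <= b -> ccont 0 T (fun t => f (t +i* y)%C).
Proof. by move=> fA yb x xT; apply: cder_ccont_at (expansible_cder_at fA xT yb). Qed.

Lemma expands_locally_bounded f z0 a rho B : expands f z0 a rho B ->
  forall z, nc (z - z0) <= rho / 2 -> nc (f z) <= 2 * B.
Proof.
move=> [_ _ fP] z /fP/(_ 0%N).
by rewrite big_ord0 subr0 expr0 divr1.
Qed.

Lemma expansible_bounded b f : expansible (rectangle T b) f ->
  exists M, forall z, rectangle T b z -> nc (f z) <= M.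
Proof.
move=> fA.
have [K K0 KP] : exists2 K, 0 < K & forall y, - b <= y <= b ->
    forall x, 0 <= x <= T -> nc (f (x +i* y)%C) <= K.
  apply: (@itv_compactness (fun K y => forall x, 0 <= x <= T -> nc (f (x +i* y)%C) <= K)).
    by move=> K L y _ KL H x /H /le_trans; apply.
  move=> y yb.
  (* Tube lemma: along the segment at height y a single K bounds f and gives the half-height K^-1 of
     a tube. A second compactness argument then runs over y. *)
  have [K K0 KP] : exists2 K, 0 < K & forall x, 0 <= x <= T ->
      forall y', `|y' - y| < K^-1 -> nc (f (x +i* y')%C) <= K.
    apply: (@itv_compactness (fun K x => forall y', `|y' - y| < K^-1 -> nc (f (x +i* y')%C) <= K)).
      move=> K L x K0 KL H y' yL; apply: (le_trans (H y' _) KL).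
      by apply: lt_le_trans yL _; rewrite lef_pV2 ?posrE // (lt_le_trans K0).
    move=> x xT; have [|a [rho [B fE]]] := fA (x +i* y)%C; first by split.
    have r0 : 0 < rho by case: fE.
    have B0 := expands_ge0 fE.
    (* 2 B bounds f near the point; 4 / rho makes the half-height at most rho / 4. *)
    have K0 : 0 < 2 * B + 4 / rho by rewrite ltr_wpDl ?mulr_ge0 // divr_gt0.
    exists (2 * B + 4 / rho) => //; exists (rho / 4); first by rewrite divr_gt0.
    move=> x' xx' y' yy'.
    apply: (@le_trans _ _ (2 * B)); last by rewrite lerDl divr_ge0 // ltW.
    apply: (expands_locally_bounded fE).
    apply: le_trans (nc_le_ReIm _) _; rewrite ReD ImD ReN ImN /=.
    have : `|y' - y| < rho / 4.
      apply: lt_le_trans yy' _; rewrite -[rho / 4]invf_div lef_pV2 ?posrE ?divr_gt0 //.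
      by rewrite lerDr mulr_ge0.
    by move: xx'; lra.
  exists K => //; exists K^-1; first by rewrite invr_gt0.
  by move=> y' yy' x xT; exact: KP.
by exists K => -[x y] [xT yb]; exact: KP.
Qed.

Section FixedFrequency.
Variables (b : R) (f : R[i] -> R[i]) (k : int).
Hypothesis fA : expansible (rectangle T b) f.
Hypothesis fper : forall y, - b <= y <= b -> f (0 +i* y)%C = f (T +i* y)%C.

Let w := omega T k%:~R.
Let c y := ci 0 T (fun x => f (x +i* y)%C * fexp T (- k) x).

Let cont_f y : - b <= y <= b -> ccont 0 T (fun x => f (x +i* y)%C * fexp T (- k) x).
Proof. by move=> yb; apply: ccontM; [exact: expansible_ccont yb|exact: ccont_fexp]. Qed.

Let cont_df y : - b <= y <= b ->
  ccont 0 T (fun x => cder f (x +i* y)%C * fexp T (- k) x).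
Proof.
by move=> yb; apply: ccontM; [exact: expansible_ccont (expansible_cder fA) yb|exact: ccont_fexp].
Qed.

(** Integration by parts over a period: the boundary terms cancel by [fper], which is how
    periodicity on the vertical edges enters the decay. *)
Lemma ci_cder_fexp y : - b <= y <= b ->
  ci 0 T (fun x => cder f (x +i* y)%C * fexp T (- k) x) = (0 +i* w)%C * c y.
Proof.
move=> yb.
have H : ci 0 T (fun x => (0 +i* - w)%C * (f (x +i* y)%C * fexp T (- k) x) +
    cder f (x +i* y)%C * fexp T (- k) x) = 0.
  rewrite (@ci_FTC2 _ _ _ _ (fun x => f (x +i* y)%C * fexp T (- k) x)) ?(ltW T0) //.
  - by rewrite fexp_atT // fexp_at0 // !mulr1 fper // subrr.
  - by move=> x xT; apply: ccont_atD; [apply: ccontZ xT; exact: cont_f|exact: (cont_df yb)].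
  - move=> x xT; rewrite mulrCA (_ : (0 +i* - w)%C = (0 +i* omega T (- k)%:~R)%C).
      apply: cder_atM; last exact: cder_at_fexp.
      exact: (expansible_cder_at fA).
    by congr (_ +i* _)%C; rewrite /w /omega intrN mulrN mulNr.
have cy := cont_f yb; have cdy := cont_df yb.
move: H; rewrite ciD //; last exact: ccontZ.
rewrite ciZ //.
move=> /eqP; rewrite addrC addr_eq0 => /eqP ->.
rewrite -mulNr; congr (_ * _); apply: complex_ext; rewrite ?ReN ?ImN /= ?oppr0 ?opprK //.
Qed.

(* c'(y) is the integral of i f'(x + iy) e_(- k)(x), that is - w c(y) after an
   integration by parts. *)
Lemma cder_at_shift y : - b < y < b -> cder_at c y ((- w)%:C%C * c y).
Proof.
move=> /andP[by1 yb1].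
have yb : - b <= y <= b by rewrite !ltW.
(* A constant uniform in x reduces differentiation under the integral sign to integrating one
   quadratic estimate. *)
have [K K0 KP] : exists2 K, 0 < K & forall x, 0 <= x <= T ->
    isder_le K f (x +i* y)%C (cder f (x +i* y)%C).
  apply: (@itv_compactness (fun K x => isder_le K f (x +i* y)%C (cder f (x +i* y)%C))).
    by move=> K L x K0 KL; exact: isder_le_trans.
  move=> x xT; have [|a [rho [B fE]]] := fA (_ : rectangle T b (x +i* y)%C); first by split.
  have [K K0 KP] := expands_isder_le fE.
  have r0 : 0 < rho by case: fE.
  exists K => //; exists (rho / 4); first by rewrite divr_gt0.
  move=> x' xx'; apply: KP; apply: le_trans (nc_le_ReIm _) _.
  by rewrite ReD ImD ReN ImN /= subrr normr0 addr0 ltW.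
(* The summands ensure in turn |s| <= K^-1, y + s in [- b, b], and the bound K s ^ 2 integrated over
   [0, T] by [ci_bound]. *)
pose L := K + (b - y)^-1 + (b + y)^-1 + 2 * K * T.
have p1 : 0 < (b - y)^-1 by rewrite invr_gt0; lra.
have p2 : 0 < (b + y)^-1 by rewrite invr_gt0; lra.
have p3 : 0 < 2 * K * T by rewrite !mulr_gt0.
have L0 : 0 < L by rewrite /L; lra.
have H s : `|s| <= L^-1 -> nc (c (y + s) - c y - ((- w)%:C%C * c y) * s%:C%C) <= L * s ^+ 2.
  move=> sL.
  have sK : `|s| <= K^-1.
    by apply: le_trans sL _; rewrite lef_pV2 ?posrE // /L; lra.
  have sb1 : `|s| <= b - y.
    by apply: le_trans sL _; rewrite -[b - y]invrK lef_pV2 ?posrE // /L; lra.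
  have sb2 : `|s| <= b + y.
    by apply: le_trans sL _; rewrite -[b + y]invrK lef_pV2 ?posrE // /L; lra.
  have ysb : - b <= y + s <= b.
    move: sb1 sb2; rewrite !ler_norml; lra.
  have -> : (- w)%:C%C * c y * s%:C%C =
      (0 +i* s)%C * ci 0 T (fun x => cder f (x +i* y)%C * fexp T (- k) x).
    rewrite ci_cder_fexp // mulrAC mulrA; congr (_ * _).
    by apply: complex_ext; rewrite ?ReM ?ImM /=; ring.
  have cy := cont_f yb; have cys := cont_f ysb; have cdy := cont_df yb.
  rewrite /c -ciZ // -ciB // -ciB //; first last.
  - exact: ccontZ.
  - exact: ccontB.
  apply: le_trans (@ci_bound _ _ _ _ (K * s ^+ 2) (ltW T0) _ _) _.
  - by apply: ccontB; [exact: ccontB|exact: ccontZ].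
  - move=> x xT.
    have -> : f (x +i* (y + s))%C * fexp T (- k) x - f (x +i* y)%C * fexp T (- k) x -
        (0 +i* s)%C * (cder f (x +i* y)%C * fexp T (- k) x) =
      (f ((x +i* y)%C + (0 +i* s)%C) - f (x +i* y)%C -
        cder f (x +i* y)%C * (0 +i* s)%C) * fexp T (- k) x.
      rewrite (_ : (x +i* y)%C + (0 +i* s)%C = (x +i* (y + s))%C); first by ring.
      by apply: complex_ext; rewrite ?ReD ?ImD /= ?addr0.
    rewrite ncM nc_fexp mulr1; apply: le_trans (KP _ xT _ _) _; rewrite nc_imag //.
    by rewrite real_normK ?num_real.
  rewrite subr0 (_ : 2 * _ = 2 * K * T * s ^+ 2); last by ring.
  by rewrite ler_wpM2r ?sqr_ge0 // /L; lra.
split; apply: (is_derive_quadratic L0) => s /H.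
  apply: le_trans; apply: le_trans (Re_le_nc _).
  by rewrite !ReD !ReN [_ * s%:C%C]mulrC !Re_realM [s * _]mulrC.
apply: le_trans; apply: le_trans (Im_le_nc _).
by rewrite !ImD !ImN [_ * s%:C%C]mulrC !Im_realM [s * _]mulrC.
Qed.

(** Integrating factor: phi(y) e^(v y) has derivative 0, hence is constant by the mean value
    theorem. *)
Lemma linear_ode (phi : R -> R) (v : R) : 0 < b ->
  (forall y, - b < y < b -> is_derive y 1 phi (- v * phi y)) ->
  forall y, - b < y < b -> phi 0 = phi y * expR (v * y).
Proof.
move=> b0 dphi.
pose g y := phi y * expR (v * y).
have dg y : - b < y < b -> is_derive y 1 g 0.
  move=> /dphi dy.
  have lin : is_derive y 1 (fun t => v * t) v.
    rewrite (_ : (fun t => _) = v \*: id); last by apply/funext.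
    by apply: is_derive_eq; rewrite /GRing.scale /= mulr1.
  rewrite (_ : g = phi * (expR \o (fun t => v * t))) //.
  by apply: is_derive_eq; rewrite /GRing.scale /=; ring.
have g0 y z : - b < y -> y <= z -> z < b -> g z = g y.
  move=> y0 yz zb.
  have [||t _] := @MVT_segment R g (fun=> 0) y z yz.
  - move=> t; rewrite in_itv /= => /andP[yt tz]; apply: dg.
    by rewrite (lt_trans y0) // (lt_trans tz).
  - apply: continuous_itv_within => t /andP[yt tz].
    apply: is_derive_continuous (dg t _).
    by rewrite (lt_le_trans y0) // (le_lt_trans tz).
  - by move=> /eqP; rewrite mul0r subr_eq0 => /eqP.
move=> y /andP[y1 y2]; rewrite -/(g y).
have -> : phi 0 = g 0 by rewrite /g mulr0 expR0 mulr1.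
by case: (leP 0 y) => y0; [apply/esym/g0 | apply: g0] => //; rewrite ?ltW //; lra.
Qed.

Lemma fcoef_decay M : 0 < b -> (forall z, rectangle T b z -> nc (f z) <= M) ->
  nc (fcoef T (fun x => f x%:C%C) k) <= 2 * M * expR (- omega T b) ^+ `|k|%N.
Proof.
move=> b0 fM.
have M0 : 0 <= M.
  apply: le_trans (nc_ge0 _) (fM 0 _).
  by split; rewrite /= ?lexx ?(ltW T0) // oppr_le0 ltW.
have c_shift y : - b < y < b -> c 0 = (expR (w * y))%:C%C * c y.
  move=> yb; apply: complex_ext; rewrite ?Re_realM ?Im_realM mulrC.
    apply: (@linear_ode (fun y => complex.Re (c y)) w) => // t tb.
    by have [] := cder_at_shift tb; rewrite Re_realM.
  apply: (@linear_ode (fun y => complex.Im (c y)) w) => // t tb.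
  by have [] := cder_at_shift tb; rewrite Im_realM.
have cM y : - b < y < b -> nc (c 0) <= expR (w * y) * (2 * (M * T)).
  move=> yb; rewrite (c_shift y yb) ncM nc_real ger0_norm ?expR_ge0 //.
  rewrite ler_wpM2l ?expR_ge0 // -[T in M * T]subr0.
  have yb' : - b <= y <= b by case/andP: yb => *; rewrite !ltW.
  apply: ci_bound (ltW T0) _ _; first exact: cont_f.
  by move=> x xT; rewrite ncM nc_fexp mulr1; apply: fM; split.
(* The height is - t or t according to the sign of w, so that the factor decays in both cases. *)
have cB t : 0 < t < b -> nc (c 0) <= expR (- `|w| * t) * (2 * (M * T)).
  move=> /andP[t0 tb]; case: (leP 0 w) => w0.
    by rewrite ger0_norm // mulNr -mulrN; apply: cM; apply/andP; split; lra.
  by rewrite ltr0_norm // opprK; apply: cM; apply/andP; split; lra.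
(* The equation holds at interior heights only; the full rate is a left limit at b. *)
have cBb : nc (c 0) <= expR (- `|w| * b) * (2 * (M * T)).
  have cv : (fun t => expR (- `|w| * t) * (2 * (M * T))) @ b^'- -->
      expR (- `|w| * b) * (2 * (M * T)).
    apply: cvg_at_left_filter; apply: cvgM; last exact: cvg_cst.
    apply: (@cvg_comp _ _ _ (fun t => - `|w| * t) expR); last exact: continuous_expR.
    by apply: cvgM; [exact: cvg_cst|exact: cvg_id].
  apply: (ler_cvg_to (cvg_cst _) cv); near=> t; apply: cB.
  by apply/andP; split; near: t; [exact: nbhs_left_gt|exact: nbhs_left_lt].
rewrite /fcoef ncM nc_real ger0_norm ?invr_ge0 ?(ltW T0) // mulrC ler_pdivrMr //.
apply: le_trans cBb _.
rewrite -expRM_natl (_ : `|k|%N%:R * - omega T b = - `|w| * b); last first.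
  rewrite /w /omega !normrM normfV (gtr0_norm T0) (gtr0_norm (pi_gt0 R)) normr_nat.
  by rewrite -intr_norm natr_absz -abszE; ring.
by rewrite le_eqVlt; apply/orP; left; apply/eqP; ring.
Unshelve. all: by end_near. Qed.

End FixedFrequency.

End ContourShift.

(** * Fundamental lemma of the calculus of variations *)

Section WeakDerivatives.
Context {R : realType}.
Variable T : R.
Hypothesis T0 : 0 < T.
Local Notation nc := (@Normc.normc R).
Local Notation mu := (@lebesgue_measure R).
Implicit Types (f : R[i] -> R[i]) (phi w : R -> R) (x : R).

Lemma Rintegral_oo_cc w : mu.-integrable `[0, T] (EFin \o w) ->
  \int[mu]_(x in `]0, T[) w x = \int[mu]_(x in `[0, T]) w x.
Proof.
move=> iw; rewrite Rintegral_itv_bndo_bndc.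
  by rewrite Rintegral_itv_obnd_cbnd //; apply: integrableS iw => //; exact: subset_itv_oc_cc.
by apply: integrableS iw => //; exact: subset_itv_oo_cc.
Qed.

Lemma Rintegral_subset (A B : set R) w : measurable A -> measurable B -> A `<=` B ->
  mu.-integrable B (EFin \o w) -> (forall x, B x -> 0 <= w x) ->
  \int[mu]_(x in A) w x <= \int[mu]_(x in B) w x.
Proof.
move=> mA mB AB iw w0; rewrite /Rintegral fine_le //.
- by apply: integrable_fin_num => //; exact: integrableS iw.
- exact: integrable_fin_num.
- apply: ge0_subset_integral => //.
  exact: measurable_int iw.
Qed.

(** 2 max(t, 0)^2 without a case distinction: a C^1 function vanishing for t <= 0. *)
Definition ramp2 (t : R) : R := t ^+ 2 + t * `|t|.

Lemma is_derive_ramp2 (t : R) : is_derive t 1 ramp2 (2 * t + 2 * `|t|).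
Proof.
apply: (@is_derive_quadratic _ _ _ _ 2) => // h _.
rewrite /ramp2 ler_norml.
have h2 := sqr_ge0 h; have t2 := sqr_ge0 t; have th2 := sqr_ge0 (t + h).
have [ht|ht] := lerP 0 t; have [hth|hth] := lerP 0 (t + h).
- by rewrite !ger0_norm //; apply/andP; split; nra.
- have p : 0 <= t * - (t + h) by rewrite mulr_ge0 // oppr_ge0 ltW.
  by rewrite (ger0_norm ht) (ltr0_norm hth); apply/andP; split; nra.
- have p : 0 <= - t * (t + h) by rewrite mulr_ge0 // oppr_ge0 ltW.
  by rewrite (ltr0_norm ht) (ger0_norm hth); apply/andP; split; nra.
- by rewrite !ltr0_norm //; apply/andP; split; nra.
Qed.

Lemma ramp2_eq0 t : t <= 0 -> ramp2 t = 0.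
Proof. by move=> t0; rewrite /ramp2 ler0_norm //; ring. Qed.

Lemma ramp2_ge t s : 0 <= s -> s <= t -> 2 * s ^+ 2 <= ramp2 t.
Proof.
move=> s0 st; rewrite /ramp2 ger0_norm ?(le_trans s0) //; nra.
Qed.

Lemma ramp2_ge0 t : 0 <= ramp2 t.
Proof.
rewrite /ramp2; have [t0|t0] := lerP 0 t; last by rewrite ltr0_norm //; nra.
by rewrite addr_ge0 ?sqr_ge0 ?mulr_ge0.
Qed.

(** For r > 0, a C^1 bump with support [c - r, c + r]. *)
Definition bump (c r x : R) : R := ramp2 (r ^+ 2 - (x - c) ^+ 2).

Lemma is_derive_bump (c r x : R) : is_derive x 1 (bump c r)
  ((2 * (r ^+ 2 - (x - c) ^+ 2) + 2 * `|r ^+ 2 - (x - c) ^+ 2|) * (- (2 * (x - c)))).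
Proof.
have H : is_derive x 1 (fun t => r ^+ 2 - (t - c) ^+ 2) (- (2 * (x - c))).
  apply: (@is_derive_quadratic _ _ _ _ 1) => // h _.
  rewrite (_ : _ - _ - _ = - h ^+ 2); last by ring.
  by rewrite normrN mul1r ger0_norm ?sqr_ge0.
have D := is_derive_ramp2 (r ^+ 2 - (x - c) ^+ 2).
exact: (@is_derive1_comp _ ramp2 (fun t => r ^+ 2 - (t - c) ^+ 2)).
Qed.

Lemma bump_test c r : 0 < r -> 0 < c - r -> c + r < T -> test_function 0 T (bump c r).
Proof.
move=> r0 cr0 crT; split.
- by move=> x; have [] := is_derive_bump c r x.
- rewrite (_ : derive1 _ = fun x => (2 * (r ^+ 2 - (x - c) ^+ 2) +
    2 * `|r ^+ 2 - (x - c) ^+ 2|) * (- (2 * (x - c)))); last first.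
    by apply/funext => x; rewrite derive1E; apply: derive_val; exact: is_derive_bump.
  have cu : continuous (fun x => x - c).
    by move=> x; apply: cvgB; [exact: cvg_id|exact: cvg_cst].
  have cq : continuous (fun x => r ^+ 2 - (x - c) ^+ 2).
    by move=> x; apply: cvgB; [exact: cvg_cst|apply: cvgM; exact: cu].
  move=> x; apply: cvgM.
    apply: cvgD; apply: cvgM; [exact: cvg_cst|exact: cq|exact: cvg_cst|].
    by apply: cvg_norm; exact: cq.
  by apply: cvgN; apply: cvgM; [exact: cvg_cst|exact: cu].
- exists (c - r), (c + r); split => // x; rewrite in_itv /= negb_and -!ltNge => H.
  apply: ramp2_eq0; case/orP: H => H; nra.
Qed.

Lemma test_ends phi : test_function 0 T phi -> phi 0 = 0 /\ phi T = 0.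
Proof.
move=> [_ _ [c [d [c0 dT phi0]]]]; split; apply: phi0; rewrite in_itv /= negb_and -!ltNge.
  by rewrite c0.
by rewrite dT orbT.
Qed.

Lemma test_continuous phi : test_function 0 T phi -> continuous phi.
Proof.
by move=> [dphi _ _] x; apply: differentiable_continuous; exact/derivable1_diffP.
Qed.

Lemma within_continuousM w phi : {within `[0, T], continuous w} -> continuous phi ->
  {within `[0, T], continuous (fun x => w x * phi x)}.
Proof.
move=> cw cphi; have cphi' : {within `[0, T], continuous phi} by exact: continuous_subspaceT.
by move=> x; apply: cvgM; [exact: cw|exact: cphi'].
Qed.

Lemma within_integrable w : {within `[0, T], continuous w} ->
  mu.-integrable `[0, T] (EFin \o w).
Proof. by move=> cw; apply: continuous_compact_integrable => //; exact: segment_compact. Qed.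

(** If w(c) > 0, then w >= w(c) / 2 near c, and a bump concentrated there has a positive integral
    against w. *)
Lemma variational_nonpos w : {within `[0, T], continuous w} ->
  (forall phi, test_function 0 T phi -> \int[mu]_(x in `[0, T]) (w x * phi x) = 0) ->
  forall x, 0 < x < T -> w x <= 0.
Proof.
move=> cw wphi c /andP[c0 cT]; rewrite leNgt; apply/negP => wc.
have [cw' _ _] := (continuous_within_itvP w T0).1 cw.
have /cw' /cvgrPdist_lt/(_ (w c / 2)) : c \in `]0, T[ by rewrite in_itv /= c0.
rewrite divr_gt0 // => /(_ isT) /nbhs_ballP[e /= e0 eP].
(* The bump must live where w > w(c) / 2 and have its support inside ]0, T[. *)
pose r := Num.min (e / 2) (Num.min (c / 2) ((T - c) / 2)).
have r0 : 0 < r by rewrite /r !lt_min !divr_gt0 // subr_gt0.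
have re : r < e by rewrite /r gt_min ltr_pdivrMr // ltr_pMr // ltr1n.
have rc : r <= c / 2 by rewrite /r !ge_min lexx orbT.
have rT : r <= (T - c) / 2 by rewrite /r !ge_min lexx !orbT.
have test : test_function 0 T (bump c r) by apply: bump_test => //; lra.
have cb := test_continuous test.
have wb := wphi _ test.
have lower x : 0 <= x <= T -> w c / 2 * bump c r x <= w x * bump c r x.
  move=> xT; case: (ltP `|c - x| r) => xr.
    rewrite ler_wpM2r ?ramp2_ge0 //.
    by have := eP x (lt_trans xr re); rewrite /= ltr_norml; lra.
  rewrite /bump ramp2_eq0 ?mulr0 //.
  rewrite subr_le0 -(real_normK (num_real (x - c))) distrC lerXn2r // nnegrE ltW //.
have int_bump : 0 < \int[mu]_(x in `[0, T]) bump c r x.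
  have sub : `[c - r / 2, c + r / 2]%classic `<=` `[0, T]%classic.
    move=> x; rewrite /= ?in_itv /= => /andP[h1 h2]; apply/andP; split; lra.
  have ib : mu.-integrable `[0, T] (EFin \o bump c r).
    by apply: continuous_itv_integrable => x _; exact: cb.
  have := @Rintegral_subset _ _ _ _ _ sub ib (fun x _ => ramp2_ge0 _).
  move=> /(_ (measurable_itv _) (measurable_itv _)); apply: lt_le_trans.
  have h : c - r / 2 <= c + r / 2 by lra.
  (* On [c - r / 2, c + r / 2], r^2 - (x - c)^2 is at least 3 r^2 / 4, so the bump is at least 2 (3
     r^2 / 4)^2. *)
  apply: (@lt_le_trans _ _ (2 * (r ^+ 2 * 3 / 4) ^+ 2 * (c + r / 2 - (c - r / 2)))).
    by rewrite !mulr_gt0 ?exprn_gt0 ?mulr_gt0 ?exprn_gt0 //; lra.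
  rewrite -(Rintegral_cst_itv _ h); apply: le_Rintegral => //; first last.
  - move=> x; rewrite /= ?in_itv /= => /andP[h1 h2]; apply: ramp2_ge; nra.
  - exact: integrableS ib.
  - by apply: continuous_itv_integrable => x _; exact: cvg_cst.
have : \int[mu]_(x in `[0, T]) (w c / 2 * bump c r x) <=
       \int[mu]_(x in `[0, T]) (w x * bump c r x).
  apply: le_Rintegral => //.
  - apply: integrableZl_itv; apply: continuous_itv_integrable => x _; exact: cb.
  - by apply: within_integrable; exact: within_continuousM.
rewrite wb RintegralZl_itv; last by apply: continuous_itv_integrable => x _; exact: cb.
by rewrite leNgt mulr_gt0 // divr_gt0.
Qed.

Lemma variational_eq0 w : {within `[0, T], continuous w} ->
  (forall phi, test_function 0 T phi -> \int[mu]_(x in `[0, T]) (w x * phi x) = 0) ->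
  forall x, 0 <= x <= T -> w x = 0.
Proof.
move=> cw wphi.
have inner x : 0 < x < T -> w x = 0.
  move=> xT; apply/eqP; rewrite eq_le (variational_nonpos cw wphi) //=.
  rewrite -oppr_le0; apply: (@variational_nonpos (fun t => - w t)) => //.
    by move=> t; apply: cvgN; exact: cw.
  move=> phi test; transitivity (-1 * \int[mu]_(x in `[0, T]) (w x * phi x)); last first.
    by rewrite wphi // mulr0.
  rewrite -RintegralZl_itv; first by apply: eq_Rintegral => t _; rewrite mulN1r mulNr.
  by apply: within_integrable; apply: within_continuousM => //; exact: test_continuous.
have [_ c0 cT] := (continuous_within_itvP w T0).1 cw.
have edge (F : set_system R) (l : R) : ProperFilter F -> w @ F --> l ->
    (\forall y \near F, 0 < y < T) -> l = 0.
  move=> PF wl near0; apply: (@cvg_unique _ _ (w @ F)) => //.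
  apply: cvg_trans (_ : cst 0 @ F --> 0); last exact: cvg_cst.
  apply: near_eq_cvg; apply: filterS near0 => y /inner; exact: esym.
move=> x /andP[]; rewrite le_eqVlt => /predU1P[<- _|x0].
  apply: edge c0 _; near=> y; apply/andP; split; near: y;
    [exact: nbhs_right_gt|exact: nbhs_right_lt].
rewrite le_eqVlt => /predU1P[->|xT]; last by apply: inner; rewrite x0.
by apply: edge cT _; near=> y; apply/andP; split; near: y;
  [exact: nbhs_left_gt|exact: nbhs_left_lt].
Unshelve. all: by end_near. Qed.

End WeakDerivatives.

(** * From periodic derivatives at 0 and T to periodicity on the vertical edges *)

Section EdgePeriodicity.
Context {R : realType}.
Variable T : R.
Hypothesis T0 : 0 < T.
Local Notation nc := (@Normc.normc R).
Local Notation mu := (@lebesgue_measure R).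
Implicit Types (f : R[i] -> R[i]) (phi : R -> R) (x y b : R).

Lemma Re_continuous : continuous (fun z : R[i]^o => complex.Re z : R).
Proof.
move=> z A /nbhs_normP[e e0 eA].
apply: (nbhs_complexP (fun t => A (complex.Re t)) z).2; exists e => // t tz.
by apply: eA; rewrite /= -ReN -ReD; apply: le_lt_trans tz; rewrite ncB; exact: Re_le_nc.
Qed.

Lemma Im_continuous : continuous (fun z : R[i]^o => complex.Im z : R).
Proof.
move=> z A /nbhs_normP[e e0 eA].
apply: (nbhs_complexP (fun t => A (complex.Im t)) z).2; exists e => // t tz.
by apply: eA; rewrite /= -ImN -ImD; apply: le_lt_trans tz; rewrite ncB; exact: Im_le_nc.
Qed.

(** Test functions vanish at 0 and T, so integration by parts makes G' a weak derivative of G as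
    well; W - G' is continuous and orthogonal to all test functions. *)
Lemma weak_derivative_uniq (G G' W : R -> R) :
  (forall x, 0 <= x <= T -> is_derive x 1 G (G' x)) ->
  (forall x, 0 <= x <= T -> {for x, continuous G'}) ->
  {within `[0, T], continuous W} ->
  (forall phi, test_function 0 T phi ->
    \int[mu]_(x in `]0, T[) (G x * derive1 phi x) =
    - \int[mu]_(x in `]0, T[) (W x * phi x)) ->
  forall x, 0 <= x <= T -> W x = G' x.
Proof.
move=> dG cG' cW H x xT; apply/eqP; rewrite -subr_eq0; apply/eqP.
have cwG' : {within `[0, T], continuous G'} by exact: continuous_itv_within.
apply: (@variational_eq0 R T T0 (fun t => W t - G' t)) xT.
  by move=> t; apply: cvgB; [exact: cW|exact: cwG'].
move=> phi test; have cphi := test_continuous test.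
have [dphi cphi' _] := test.
have cG t : 0 <= t <= T -> {for t, continuous G} by move=> /dG/is_derive_continuous.
have i1 : mu.-integrable `[0, T] (EFin \o (fun t => G t * derive1 phi t)).
  by apply: continuous_itv_integrable => t tT; apply: cvgM; [exact: cG|exact: cphi'].
have i2 : mu.-integrable `[0, T] (EFin \o (fun t => W t * phi t)).
  by apply: within_integrable; exact: within_continuousM.
have i3 : mu.-integrable `[0, T] (EFin \o (fun t => G' t * phi t)).
  by apply: within_integrable; exact: within_continuousM.
have := H phi test; rewrite !Rintegral_oo_cc // => E1.
have E2 : \int[mu]_(t in `[0, T]) (G t * derive1 phi t + G' t * phi t) = 0.
  have [p0 pT] := test_ends test.
  transitivity (G T * phi T - G 0 * phi 0); last by rewrite p0 pT !mulr0 subrr.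
  apply: (@Rintegral_FTC2 _ _ (fun t => G t * phi t)) (ltW T0) _ _.
  - move=> t tT; apply: cvgD; apply: cvgM;
      [exact: cG|exact: cphi'|exact: cG'|exact: cphi].
  - move=> t tT; have Dp : is_derive t 1 phi (derive1 phi t).
      by rewrite derive1E; exact: derivableP.
    have Dg := dG t tT.
    rewrite (_ : (fun s => _) = G * phi) //.
    by apply: is_derive_eq; rewrite /GRing.scale /=; ring.
under eq_Rintegral do rewrite mulrBl.
rewrite RintegralB //.
by move: E2; rewrite RintegralD // E1 => /eqP; rewrite addrC subr_eq0 => /eqP ->; rewrite subrr.
Qed.

Lemma expansible_iter_cder b f j : expansible (rectangle T b) f ->
  expansible (rectangle T b) (iter j cder f).
Proof. by move=> fA; elim: j => // j IH; exact: expansible_cder. Qed.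

(** By induction on j < s, the representative [v j] equals the j-th complex derivative on [0, T];
    the endpoint condition on [v j] is thereby transferred. The restriction to j < s keeps to the
    continuous representatives. *)
Lemma HT_iter_cder s b f : 0 < b -> expansible (rectangle T b) f ->
  HT T s (fun x => f x%:C%C) ->
  forall j, (j < s)%N -> iter j cder f 0%:C%C = iter j cder f T%:C%C.
Proof.
move=> b0 fA [v [v0 _ vweak vcont _]].
have zb : - b <= 0 <= b by rewrite oppr_le0 ltW.
have vg j : (j < s)%N -> forall x, 0 <= x <= T -> v j x = iter j cder f x%:C%C.
  elim: j => [_ x xT|j IH js x xT]; first by rewrite v0 ?in_itv.
  have {}IH := IH (ltnW js).
  have jA := expansible_iter_cder j fA; have jA' := expansible_cder jA.
  have [cv _] := vcont _ js.
  have weak := vweak _ (ltnW js).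
  have in_oo t : t \in `]0, T[%classic -> 0 <= t <= T.
    by rewrite inE /= in_itv /= => /andP[? ?]; rewrite !ltW.
  apply: complex_ext.
    apply: (@weak_derivative_uniq (fun t => complex.Re (iter j cder f t%:C%C))
      (fun t => complex.Re (iter j.+1 cder f t%:C%C)) (fun t => complex.Re (v j.+1 t))) xT.
    - by move=> t tT; have [] := expansible_cder_at jA tT zb.
    - by move=> t tT; have [] := expansible_ccont jA' zb tT.
    - by move=> t; apply: (continuous_comp (cv t)); exact: Re_continuous.
    - move=> phi test; have := weak phi test => /(congr1 (@complex.Re R)).
      rewrite ReN /=.
      under eq_Rintegral => t tT.
        rewrite mulrC Re_realM mulrC (IH _ (in_oo t tT)); over.
      under [X in _ = - X -> _]eq_Rintegral => t tT.
        rewrite mulrC Re_realM mulrC; over.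
      done.
  apply: (@weak_derivative_uniq (fun t => complex.Im (iter j cder f t%:C%C))
    (fun t => complex.Im (iter j.+1 cder f t%:C%C)) (fun t => complex.Im (v j.+1 t))) xT.
  - by move=> t tT; have [] := expansible_cder_at jA tT zb.
  - by move=> t tT; have [] := expansible_ccont jA' zb tT.
  - by move=> t; apply: (continuous_comp (cv t)); exact: Im_continuous.
  - move=> phi test; have := weak phi test => /(congr1 (@complex.Im R)).
    rewrite ImN /=.
    under eq_Rintegral => t tT.
      rewrite mulrC Im_realM mulrC (IH _ (in_oo t tT)); over.
    under [X in _ = - X -> _]eq_Rintegral => t tT.
      rewrite mulrC Im_realM mulrC; over.
    done.
move=> j js; have [_ per] := vcont _ js.
by rewrite -!vg // ?lexx ?(ltW T0) // per.
Qed.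

Lemma expands_coef0 f z0 a rho B : expands f z0 a rho B -> (forall n, a n = 0) ->
  forall z, nc (z - z0) <= rho / 2 -> f z = 0.
Proof.
move=> [_ _ fP] a0 z zr; apply: nc_eq0.
apply: (@le_of_geometric _ _ _ (2 * B)) => n.
have := fP z zr n; rewrite big1 ?subr0 ?add0r // => i _.
by rewrite a0 mul0r.
Qed.

Lemma edge_periodic b f : 0 < b -> expansible (rectangle T b) f ->
  HT_infty T (fun x => f x%:C%C) ->
  forall y, - b <= y <= b -> f (0 +i* y)%C = f (T +i* y)%C.
Proof.
move=> b0 fA fH.
pose d z := f z - f (z + T%:C%C).
have shiftT y : (0 +i* y)%C + T%:C%C = (T +i* y)%C.
  by apply: complex_ext; rewrite ?ReD ?ImD /= ?add0r ?addr0.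
have dE y : - b <= y <= b -> exists a rho B, expands d (0 +i* y)%C a rho B.
  move=> yb; have [|a [rho [B E]]] := fA (0 +i* y)%C; first by split; rewrite //= lexx ltW.
  have [|a' [rho' [B' E']]] := fA (T +i* y)%C; first by split; rewrite //= lexx ltW.
  exists (fun n => a n - a' n), (Num.min rho rho'), (B + B').
  by apply: expandsB => //; apply: expands_shift; rewrite shiftT.
have near_of (P : R -> Prop) y (e : R) : 0 < e -> (forall t, `|t - y| < e -> P t) ->
    \forall t \near y, P t.
  by move=> e0 H; apply/nbhs_ballP; exists e => //= t ty; apply: H; rewrite distrC.
have imE t y : nc ((0 +i* t)%C - (0 +i* y)%C) = `|t - y|.
  by rewrite -nc_imag; congr nc; apply: complex_ext; rewrite ?ReD ?ImD ?ReN ?ImN /= ?subrr.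
have d_at0 : \forall t \near (0 : R), d (0 +i* t)%C = 0.
  have [|a [rho [B E]]] := fA 0%:C%C; first by split; rewrite /= ?lexx ?oppr_le0 ltW.
  have [|a' [rho' [B' E']]] := fA T%:C%C; first by split; rewrite /= ?lexx ?oppr_le0 ltW.
  have aE n : a n - a' n = 0.
    (* Order n + 1 is used because endpoint values agree only for derivatives of order below s; n!
       is then cancelled. *)
    have := HT_iter_cder b0 fA (fH n.+1) (ltnSn n).
    have [r1 [B1 E1]] := expands_iter_cder n E.
    have [r2 [B2 E2]] := expands_iter_cder n E'.
    rewrite (expands_at E1) (expands_at E2) !iter_dcoef => /mulfI -> //.
      by rewrite subrr.
    by rewrite pnatr_eq0 ffactnn -lt0n fact_gt0.
  have dE0 : expands d 0%:C%C (fun n => a n - a' n) (Num.min rho rho') (B + B').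
    by apply: expandsB => //; apply: expands_shift; rewrite add0r.
  have r0 : 0 < Num.min rho rho' by case: dE0.
  apply: (near_of _ _ (Num.min rho rho' / 2)); first by rewrite divr_gt0.
  move=> t tr; apply: (expands_coef0 dE0 aE).
  by rewrite -[0%:C%C]/((0 +i* 0)%C) imE ltW.
(* Connectedness is applied to the interior of the zero set: openness is then free, and closedness
   is where analyticity enters. *)
pose P := [set t : R | d (0 +i* t)%C = 0].
have AE : `[- b, b]%classic `&` P° = `[- b, b]%classic.
  apply: (@segment_connected R (- b) b).
  - exists 0; split; last exact: d_at0.
    by rewrite /= in_itv /= oppr_le0 ltW.
  - by exists P° => //; exact: open_interior.
  - exists (closure P°); first exact: closed_closure.
    apply/seteqP; split=> y [yb Py]; split=> //; first exact: subset_closure.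
    (* A limit of zeros is not an isolated zero, so d vanishes near it. *)
    have [|a [rho [B E]]] := dE y; first by move: yb; rewrite /= in_itv.
    have r0 : 0 < rho by case: E.
    have [dz|[e e0 dnz]] := expands_isolated_zero E.
      apply: (near_of _ _ (rho / 2)); first by rewrite divr_gt0.
      by move=> t ty; apply: dz; rewrite imE ltW.
    have [t [Pt ty]] := Py _ (nbhsx_ballx y e e0).
    have [ty'|ty'] := eqVneq t y; first by rewrite -ty'.
    have /eqP[] : d (0 +i* t)%C != 0.
      by apply: dnz; rewrite imE normr_gt0 subr_eq0 ty' /= distrC.
    exact: nbhs_singleton Pt.
move=> y yb; have : (`[- b, b]%classic `&` P°) y by rewrite AE /= in_itv.
move=> [_ /nbhs_singleton]; rewrite /P /= /d shiftT => /eqP.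
by rewrite subr_eq0 => /eqP.
Qed.

Lemma analytic_near_expansible (A : set R[i]) f : analytic_near A f -> expansible A f.
Proof. by move=> [U [_ AU Uf]] z /AU/Uf; exact: analytic_at_expands. Qed.

End EdgePeriodicity.

(** * The essential supremum norm and the theorem *)

Section EssentialSupremum.
Context {R : realType}.
Variable T : R.
Hypothesis T0 : 0 < T.
Local Notation nc := (@Normc.normc R).
Local Notation mu := (@lebesgue_measure R).
Implicit Types (f : R[i] -> R[i]) (x y b : R).

(** The interval lies to the right of x, or to its left when x = b, and so keeps positive length at
    the ends. *)
Lemma subinterval_near (a b x d : R) : a < b -> a <= x <= b -> 0 < d ->
  exists c e, [/\ c < e, a <= c, e <= b & forall t, c <= t <= e -> `|t - x| < d].
Proof.
move=> ab /andP[ax xb] d0.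
have [xb'|bx] := ltP x b.
  exists x, (Num.min b (x + d / 2)); split => //.
  - by rewrite lt_min xb' ltrDl divr_gt0.
  - by rewrite ge_min lexx.
  - move=> t /andP[xt]; rewrite le_min => /andP[_ td].
    by rewrite ger0_norm ?subr_ge0 //; lra.
exists (Num.max a (x - d / 2)), x; split => //.
- by rewrite gt_max (lt_le_trans ab) //= gtrBl divr_gt0.
- by rewrite le_max lexx.
- move=> t /andP[]; rewrite ge_max => /andP[_ td] tx.
  by rewrite ler0_norm ?subr_le0 //; lra.
Qed.

Lemma isder_near f z d (e : R) : isder f z d -> 0 < e ->
  exists2 r : R, 0 < r & forall h, nc h <= r -> nc (f (z + h) - f z) < e.
Proof.
move=> [K K0 KP] e0.
have D0 : 0 < nc d + 1 by rewrite ltr_wpDl ?nc_ge0.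
exists (Num.min K^-1 (e / (nc d + 1) / 2)).
  by rewrite lt_min invr_gt0 K0 !divr_gt0.
move=> h; rewrite le_min => /andP[hK he].
rewrite (_ : f (z + h) - f z = (f (z + h) - f z - d * h) + d * h); last by ring.
apply: le_lt_trans (ncD _ _) _; rewrite ncM.
apply: (@le_lt_trans _ _ ((nc d + 1) * nc h)).
  rewrite addrC mulrDl mul1r lerD //; apply: le_trans (KP h hK) _.
  rewrite expr2 mulrA ler_piMl ?nc_ge0 //.
  by rewrite mulrC -ler_pdivlMr // mul1r.
rewrite mulrC -ltr_pdivlMr //; apply: le_lt_trans he _.
by rewrite ltr_pdivrMr // ltr_pMr ?divr_gt0 // ltr1n.
Qed.

(* Every point of the rectangle, even on its boundary, is a limit of boxes of
   positive measure contained in the rectangle. *)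
Lemma A_norm_ge b f z : 0 < b -> expansible (rectangle T b) f -> rectangle T b z ->
  ((nc (f z))%:E <= A_norm T b f)%E.
Proof.
move=> b0 fA zb; rewrite leNgt; apply/negP => Az.
have [a [rho [B fE]]] := fA z zb.
have [M Mz AM] : exists2 M : R, M < nc (f z) & (A_norm T b f <= M%:E)%E.
  have A0 : (0 <= A_norm T b f)%E by exact: Lnorm_ge0.
  exists (fine (A_norm T b f)); last by rewrite fineK // ge0_fin_numE // (lt_trans Az) ?ltry.
  by rewrite -lte_fin fineK // ge0_fin_numE // (lt_trans Az) ?ltry.
have gap : 0 < nc (f z) - M by rewrite subr_gt0.
have [r r0 rP] := isder_near (expands_isder fE) gap.
have [xT yb] := zb.
have r2 : 0 < r / 2 by rewrite divr_gt0.
have bb : - b < b by lra.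
have [c1 [e1 [ce1 Tc1 e1T near1]]] := subinterval_near T0 xT r2.
have [c2 [e2 [ce2 Tc2 e2T near2]]] := subinterval_near bb yb r2.
pose Q := `[c1, e1]%classic `*` `[c2, e2]%classic.
have mQ : measurable Q by exact: measurableX.
have big p : Q p -> rectangle T b (p.1 +i* p.2)%C /\ M < nc (f (p.1 +i* p.2)%C).
  case: p => x y [] /=; rewrite !in_itv /= => /andP[x1 x2] /andP[y1 y2]; split.
    split; rewrite /=; first by rewrite (le_trans Tc1) //= (le_trans x2).
    by rewrite (le_trans Tc2) //= (le_trans y2).
  have : nc (f (z + ((x +i* y)%C - z)) - f z) < nc (f z) - M.
    apply: rP; apply: le_trans (nc_le_ReIm _) _; rewrite ReD ImD ReN ImN /=.
    have := near1 x; rewrite x1 x2 => /(_ isT).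
    have := near2 y; rewrite y1 y2 => /(_ isT); lra.
  set u := (x +i* y)%C; rewrite (_ : z + (u - z) = u); last by rewrite addrC subrK.
  rewrite ncB => H; have := nc_triangle (f u) (f z) 0; rewrite !subr0; lra.
have Qpos : (0 < (mu \x mu) Q)%E.
  have -> : (mu \x mu)%E Q = (mu `[c1, e1]%classic * mu `[c2, e2]%classic)%E.
    exact: product_measure1E.
  rewrite !lebesgue_measure_itv /= !lte_fin ce1 ce2.
  by rewrite -!EFinD -EFinM lte_fin mulr_gt0 // subr_gt0.
(* [Lnorm] at +oo is the essential supremum only when the whole space has positive measure. *)
have Tpos : (0 < (mu \x mu) setT)%E.
  apply: lt_le_trans Qpos _; apply: le_measure; rewrite ?inE //; exact: measurableT.
move: AM; rewrite /A_norm unlock Tpos => AM.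
have /ess_supP[N [mN N0 sub]] := AM.
have : ((mu \x mu) Q <= (mu \x mu) N)%E.
  apply: le_measure; rewrite ?inE // => p /big[pr pM]; apply: sub => /=.
  rewrite patchE mem_set //= lee_fin ger0_norm ?nc_ge0 // leNgt pM //.
by rewrite N0 leNgt Qpos.
Qed.

End EssentialSupremum.

(** * The error bound and its two applications *)

Section QuadratureError.
Context {R : realType}.
Local Notation nc := (@Normc.normc R).
Implicit Types (f : R[i] -> R[i]).

Lemma quadrature_error_decay (T beta : R) f (D q : R) (N : nat) (l : 'I_N) :
  0 < T -> 0 < beta -> expansible (rectangle T beta) f -> 0 <= D -> 0 <= q < 1 ->
  (0 < N)%N -> ~~ odd N ->
  (forall k : int, k != 0 -> nc (fcoef T (fun x => f x%:C%C) k) <= D * q ^+ `|k|%N) ->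
  quadrature_error T f l <= 8 * T * D * (q ^+ N./2 / (1 - q)).
Proof.
move=> T0 b0 fA D0 q01 N0 oN cD.
have zb : - beta <= 0 <= beta by rewrite oppr_le0 ltW.
apply: (@qerr_le _ T N T0 N0 l (fun x => f x%:C%C) (fun x => cder f x%:C%C)) => //.
- by move: N0 oN; lia.
- exact: expansible_ccont fA zb.
- move=> x /andP[x0 xT]; apply: (expansible_cder_at fA _ zb).
  by rewrite !ltW.
Qed.

Lemma rate_lt1 (T beta : R) : 0 < T -> 0 < beta -> 0 <= expR (- omega T beta) < 1.
Proof.
move=> T0 b0; rewrite expR_ge0 expR_lt1 oppr_lt0 /omega.
by rewrite divr_gt0 // !mulr_gt0 // pi_gt0.
Qed.

(** Since |k| >= 1, the decay factor is at most e^(- omega_b), which is the normalisation in the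
    definition: the coefficient is at most twice a quantity that tends to 0 as b grows. *)
Lemma beta_analytic_fcoef_eq0 (T beta : R) f : 0 < T -> beta_analytic T beta f ->
  forall k : int, k != 0 -> fcoef T (fun x => f x%:C%C) k = 0.
Proof.
move=> T0 [[fH _] fstrip lim0] k k0.
have fA b : expansible (rectangle T b) f.
  move=> z [zT _]; exact: (analytic_near_expansible fstrip).
apply: nc_eq0; apply/ler_addgt0Pr => e e0; rewrite add0r.
have e2 : 0 < e / 2 by rewrite divr_gt0.
have : \forall b \near +oo%R, 0 < b /\
    (A_norm T b f * ((expR (omega T b))^-1)%:E < (e / 2)%:E)%E.
  near=> b; split; first by near: b; exact: nbhs_pinfty_gt.
  near: b.
  have := lim0 [set x : \bar R | (x < (e / 2)%:E)%E].
  apply; apply: open_nbhs_nbhs; split; last by rewrite /= lte_fin.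
  exact: open_ereal_lt_ereal.
case=> M [_ MP]; have M1 : M < M + 1 by rewrite ltrDl.
have [b0 Ab] := MP _ M1.
set b := M + 1 in b0 Ab.
have Anorm0 : (0 <= A_norm T b f)%E by exact: Lnorm_ge0.
have Efin : 0 < (expR (omega T b))^-1 by rewrite invr_gt0 expR_gt0.
(* An infinite norm times a positive real would be +oo, against the bound e / 2. *)
have Afin : A_norm T b f \is a fin_num.
  rewrite ge0_fin_numE // ltNge leye_eq; apply/negP => /eqP Aoo.
  by move: Ab; rewrite Aoo gt0_mulye ?lte_fin // ltNge leey.
have fM z : rectangle T b z -> nc (f z) <= fine (A_norm T b f).
  by move=> zb; rewrite -lee_fin fineK //; exact: A_norm_ge.
move: Ab; rewrite -[A_norm T b f]fineK // -EFinM lte_fin -expRN => Ab.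
have fper := edge_periodic T0 b0 (fA b) fH.
apply: le_trans (@fcoef_decay _ T T0 b f k (fA b) fper _ b0 fM) _.
have /andP[q0 q1] := rate_lt1 T0 b0.
have M0 : 0 <= fine (A_norm T b f) by rewrite fine_ge0.
apply: (@le_trans _ _ (2 * fine (A_norm T b f) * expR (- omega T b))).
  rewrite ler_wpM2l ?mulr_ge0 // -[X in _ <= X]expr1.
  by apply: ler_wiXn2l => //; [exact: ltW | rewrite absz_gt0].
by rewrite -mulrA -ler_pdivlMl // [2^-1 * e]mulrC ltW.
Unshelve. all: by end_near. Qed.

End QuadratureError.
Unset Implicit Arguments.

Theorem corollary5p2 (R : realType) (T beta : R) (f : R[i] -> R[i])
    (hT : 0 < T) (hbeta : 0 < beta) (hf : A_space T beta f) :
  (exists K : R, \forall N \near \oo, ~~ odd N ->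
     forall l : 'I_N,
       quadrature_error T f l <= K * expR (- omega T (N%:R * beta / 2)))
  /\
  (beta_analytic T beta f ->
     forall N : nat, (0 < N)%N -> ~~ odd N ->
     forall l : 'I_N, quadrature_error T f l = 0).
Proof.
have [fH fan] := hf; have fA := analytic_near_expansible fan; split.
  have fper := edge_periodic hT hbeta fA fH.
  have [M fM] := expansible_bounded fA.
  have M0 : 0 <= M.
    apply: le_trans (nc_ge0 _) (fM 0 _).
    by split; rewrite /= ?lexx ?oppr_le0 ltW.
  pose q := expR (- omega T beta).
  have q01 : 0 <= q < 1 by exact: rate_lt1.
  (* 2 M is the constant of [fcoef_decay]; the estimate holds from N = 1 on. *)
  exists (8 * T * (2 * M) / (1 - q)); exists 1%N => // N /= N0 oN l.
  apply: le_trans (@quadrature_error_decay _ T beta f (2 * M) q N l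
    hT hbeta fA _ q01 N0 oN _) _.
  - by rewrite mulr_ge0.
  - by move=> k _; exact: (@fcoef_decay _ T hT beta f k fA fper _ hbeta fM).
  (* For N even, q ^ (N/2) is exactly e^(- omega_(N beta / 2)). *)
  - rewrite mulrCA mulrC -expRM_natl (_ : _ * - omega T beta = - omega T (N%:R * beta / 2)).
      by rewrite mulrAC -mulrA mulrCA mulrA.
    rewrite -[in RHS](even_halfK oN) -mul2n natrM /omega; field.
    by rewrite gt_eqF.
move=> fb N N0 oN l; apply/eqP; rewrite eq_le nc_ge0 andbT.
(* The coefficients with k <> 0 vanish, so D = q = 0 is admissible and the bound is 0. *)
apply: le_trans (@quadrature_error_decay _ T beta f 0 0 N l
  hT hbeta fA _ _ N0 oN _) _.
- by [].
- by rewrite lexx ltr01.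
- by move=> k k0; rewrite (@beta_analytic_fcoef_eq0 _ T beta) // Normc.normc0 mul0r.
- by rewrite mulr0 mul0r.
Qed.
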